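(* Let $K, L\subset\mathbb{R}^2$ be two smooth, strictly convex planar convex bodies with support functions $h_K(\theta)$ and $h_L(\theta)$, and let $\rho(\theta)$ be the relative curvature radius of $K$ with respect to $L$. Suppose that $K$ and $L$ are at a dilation position and that $F:(0,+\infty)\to\mathbb{R}$ is a strictly convex function. Then $$\frac{1}{V(L)}\int_{0}^{2\pi} F(\rho(\theta))\,h_L(\theta)\,\bigl(h_L(\theta)+h_L''(\theta)\bigr)\,\mathrm{d}\theta\ \ge\ F(-t_1)+F(-t_2),$$ where $t_1$ and $t_2$ are the two roots of the relative Steiner polynomial of $K$ with respect to $L$. Moreover, equality holds if and only if $K$ and $L$ are homothetic.
   Context: A planar convex body is a compact convex set $K\subset\mathbb{R}^2$ that contains the origin $o$ and has nonempty interior. $V(S)$ denotes the area of $S\subseteq\mathbb{R}^2$. For planar convex bodies $K,L$ and $t>0$, $K+L=\{x+y\mid x\in K,\ y\in L\}$ and $tK=\{tx\mid x\in K\}$. The support function of $K$ is $h_K(\theta)=\sup_{x\in K}\langle x,\mathbf{u}(\theta)\rangle$, where $\mathbf{u}(\theta)=(\cos\theta,\sin\theta)$; it is $2\pi$-periodic in $\theta$. ''Smooth, strictly convex'' bodies are understood to have smooth boundary with positive curvature, so that $h_K,h_L$ are smooth and $h_K+h_K''>0$, $h_L+h_L''>0$. The relative curvature radius of $K$ with respect to $L$ is $\rho(\theta)=\dfrac{h_K(\theta)+h_K''(\theta)}{h_L(\theta)+h_L''(\theta)}$. The relative Steiner polynomial of $K$ with respect to $L$ is the polynomial in $t$ $$V(K+tL)=V(K)+2V(K,L)\,t+V(L)\,t^2$$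 (this identity for $t>0$ defines the mixed area $V(K,L)$, and the right-hand side is then regarded as a polynomial in $t\in\mathbb{R}$). For smooth support functions, $V(K,L)=\frac12\int_0^{2\pi}h_K(h_L+h_L'')\,\mathrm{d}\theta$. By the Minkowski inequality $V(K,L)^2\ge V(K)V(L)$, it has two negative real roots (counted with multiplicity) $t_1\ge t_2$: $$t_1=\frac{-V(K,L)+\delta}{V(L)},\quad t_2=\frac{-V(K,L)-\delta}{V(L)},\quad \delta=\sqrt{V(K,L)^2-V(K)V(L)}.$$ The inradius and outradius of $K$ with respect to $L$ are $$r(K,L)=\max\{t>0\mid x+tL\subseteq K\text{ for some }x\in\mathbb{R}^2\},\qquad R(K,L)=\min\{t>0\mid x+tL\supseteq K\text{ for some }x\in\mathbb{R}^2\}.$$ $K$ and $L$ are at a dilation position if the origin $o\in K\cap L$ and $r(K,L)L\subseteq K\subseteq R(K,L)L$. $K$ and $L$ are homothetic if $K=x+tL$ for some $x\in\mathbb{R}^2$ and $t>0$. *)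

(* Defs.v *)
From HB Require Import structures.
From mathcomp Require Import all_boot all_order all_algebra.
From mathcomp Require Import ring.
From mathcomp Require Import all_classical all_reals all_analysis.

Set Implicit Arguments.
Unset Strict Implicit.
Unset Printing Implicit Defensive.

Import Order.TTheory GRing.Theory Num.Theory.
Import numFieldNormedType.Exports.

Local Open Scope classical_set_scope.
Local Open Scope ring_scope.

Section PlanarConvexBodies.
Variable R : realType.
Implicit Types (K L S : set (R * R)%type) (t : R).

Definition area S : R :=
  fine (((@lebesgue_measure R) \x (@lebesgue_measure R))%E S).

Definition mink_add K L : set (R * R)%type := [set x + y | x in K & y in L].

Definition dilate t K : set (R * R)%type := [set t *: x | x in K].

Definition translate (x : R * R) K : set (R * R)%type := [set x + y | y in K].

Definition inner2 (x y : R * R) : R := x.1 * y.1 + x.2 * y.2.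

Definition udir (theta : R) : R * R := (cos theta, sin theta).

Definition convex_body K : Prop :=
  [/\ compact K, convex_set (M := (R * R)%type) K, K (0, 0) & K° !=set0].

Definition support_fun K (theta : R) : R :=
  sup [set inner2 x (udir theta) | x in K].

Definition smooth (f : R -> R) : Prop :=
  forall (n : nat) (s : R), derivable (derive1n n f) s 1.

(* Signed curvature of the plane curve s |-> (x s, y s). *)
Definition curvature (x y : R -> R) (s : R) : R :=
  (derive1 x s * derive1n 2 y s - derive1 y s * derive1n 2 x s) /
  (Num.sqrt (derive1 x s ^+ 2 + derive1 y s ^+ 2)) ^+ 3.

(* The boundary is a regular simple closed C^oo curve whose curvature is
   everywhere positive; the curve is oriented so that the sign is +, i.e.
   counterclockwise. The period is normalized to 2 pi. *)
Definition smooth_strictly_convex K : Prop :=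
  exists x y : R -> R,
    [/\ smooth x /\ smooth y,
        periodic x (2 * pi) /\ periodic y (2 * pi),
        forall s, (derive1 x s, derive1 y s) != (0, 0) /\ 0 < curvature x y s,
        {in `[0, 2 * pi[ &, injective (fun s => (x s, y s))} &
        closure K `\` K° = range (fun s => (x s, y s))].

(* h + h'', the curvature radius *)
Definition curv_radius K (theta : R) : R :=
  support_fun K theta + derive1n 2 (support_fun K) theta.

Definition rel_curv_radius K L (theta : R) : R :=
  curv_radius K theta / curv_radius L theta.

(* The number V(K,L) for which the Steiner identity holds for all t > 0
   (it is unique; the default value of xget is 0). *)
Definition mixed_area K L : R :=
  xget 0 [set v : R | forall t, 0 < t ->
    area (mink_add K (dilate t L)) =
      area K + 2 * v * t + area L * t ^+ 2].

Definition steiner_poly K L : {poly R} :=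
  (area K)%:P + (2 * mixed_area K L) *: 'X + area L *: 'X^2.

Definition steiner_delta K L : R :=
  Num.sqrt (mixed_area K L ^+ 2 - area K * area L).

Definition steiner_root1 K L : R :=
  (- mixed_area K L + steiner_delta K L) / area L.

Definition steiner_root2 K L : R :=
  (- mixed_area K L - steiner_delta K L) / area L.

Lemma steiner_poly_factor K L : area L != 0 ->
  area K * area L <= mixed_area K L ^+ 2 ->
  steiner_poly K L = area L *:
    (('X - (steiner_root1 K L)%:P) * ('X - (steiner_root2 K L)%:P)).
Proof.
move=> L0 minkowski.
have sumr : area L * (steiner_root1 K L + steiner_root2 K L)
    = - (2 * mixed_area K L).
  by rewrite /steiner_root1 /steiner_root2; field.
have prodr : area L * (steiner_root1 K L * steiner_root2 K L) = area K.
  have d2 : steiner_delta K L ^+ 2 = mixed_area K L ^+ 2 - area K * area L.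
    by rewrite sqr_sqrtr// subr_ge0.
  have -> : area L * (steiner_root1 K L * steiner_root2 K L) =
      (mixed_area K L ^+ 2 - steiner_delta K L ^+ 2) / area L.
    by rewrite /steiner_root1 /steiner_root2; field.
  by rewrite d2; field.
rewrite /steiner_poly -{1}prodr -[2 * mixed_area K L]opprK -sumr -!mul_polyC.
by rewrite !(rmorphM, rmorphN, rmorphD)/=; ring.
Qed.

(* The max and the min of the usual definitions are attained for convex
   bodies, hence coincide with this sup and this inf. *)
Definition rel_inradius K L : R :=
  sup [set t | 0 < t /\ exists x, translate x (dilate t L) `<=` K].

Definition rel_outradius K L : R :=
  inf [set t | 0 < t /\ exists x, K `<=` translate x (dilate t L)].

Definition dilation_position K L : Prop :=
  [/\ (K `&` L) (0, 0), dilate (rel_inradius K L) L `<=` K &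
      K `<=` dilate (rel_outradius K L) L].

Definition homothetic K L : Prop :=
  exists (x : R * R) (t : R), 0 < t /\ K = translate x (dilate t L).

Definition strictly_convex_on_pos (F : R -> R) : Prop :=
  forall a b t, 0 < a -> 0 < b -> a != b -> 0 < t -> t < 1 ->
    F (t * a + (1 - t) * b) < t * F a + (1 - t) * F b.

End PlanarConvexBodies.

(* Main.v *)
Require Import Defs.
From HB Require Import structures.
From mathcomp Require Import all_boot all_order all_algebra.
From mathcomp Require Import ring lra.
From mathcomp Require Import all_classical all_reals all_analysis.

Import Order.TTheory GRing.Theory Num.Theory.
Import numFieldNormedType.Exports.

Local Open Scope classical_set_scope.
Local Open Scope ring_scope.

(** Write [h], [k] for the support functions of [K], [L] and [S = h + h''],
    [T = k + k''] for their curvature radii, so that [rho = S / T]. Integration by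
    parts around the circle shows that areas and mixed areas are half the integrals
    of [h S], [k T] and [h T] ([area_support], [mixed_area_support]). Put
    [a = V(K,L) / V(L)] and [d = delta / V(L)]; the opposites of the two Steiner
    roots are [a - d] and [a + d].

    The geometric input is the relative Bonnesen inequality: the inradius [r] and the
    outradius [R] lie between [a - d] and [a + d]. For [f = h - r k] (or [h - R k]),
    the Steiner polynomial at [- r] is half the integral of [f (f + f'')], i.e. of
    [f^2 - f'^2]. Extremality of [r] means that the contact directions, the zeros of
    [f], meet every closed half circle ([half_circle_push]); Wirtinger's inequality
    on the arcs between zeros, of length at most [pi], then makes this integral
    nonpositive ([wirtinger_circle]). In a dilation position [r k <= h <= R k], hence
    [|h - a k| <= d k] pointwise ([bonnesen_support]).

    If [d = 0] this says [h = a k], and the bodies are homothetic. If [d > 0], let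
    [w = (h - a k) / d], so that [|w| <= k]. Let [lp] and [lm] be the tangent lines of
    [F] at [a + d] and [a - d]. Since [F] lies above both,
    [F(rho) k T >= ((k - w) lp(rho) + (k + w) lm(rho)) T / 2], and the integral of the
    right-hand side involves only the integrals of [k T], [h T], [k S] and [h S]: it is
    exactly [V(L) (F(a - d) + F(a + d))]. Equality would force [rho] to take only
    the values [a - d] and [a + d], so [rho] would be constant, although its mean for
    the weight [k T] is [a] ([strict_inequality]).

    Before this, the hypotheses on the boundary curves must be turned into analysis.
    Every boundary point of a convex body is a support point, and positive curvature
    lets the normal angle be inverted locally, which makes the support function twice
    continuously differentiable with [h + h'' > 0] ([smooth_support_C2]). The area
    formula follows from Fubini over vertical slices, whose ends are parametrized by
    the normal angle ([area_line_integral]). *)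

(** * Calculus on the real line *)

Section RealCalculus.
Context {R : realType}.
Implicit Types (f g F : R -> R) (a b c x : R).

(** The rules below are on applied forms such as [f y + g y], the shape matched by the
    tactics [derive_expr] and [continuity_expr]. *)
Lemma is_deriveD_fun f g x df dg : is_derive x 1 f df -> is_derive x 1 g dg ->
  is_derive x 1 (fun y => f y + g y) (df + dg).
Proof. by move=> ? ?; exact: is_deriveD. Qed.

Lemma is_deriveB_fun f g x df dg : is_derive x 1 f df -> is_derive x 1 g dg ->
  is_derive x 1 (fun y => f y - g y) (df - dg).
Proof. by move=> ? ?; exact: is_deriveB. Qed.

Lemma is_deriveN_fun f x df : is_derive x 1 f df ->
  is_derive x 1 (fun y => - f y) (- df).
Proof. by move=> ?; exact: is_deriveN. Qed.

Lemma is_deriveM_fun f g x df dg : is_derive x 1 f df -> is_derive x 1 g dg ->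
  is_derive x 1 (fun y => f y * g y) (f x * dg + df * g x).
Proof.
move=> Df Dg; rewrite (mulrC df).
exact: (@is_deriveM _ _ f g x 1 df dg Df Dg).
Qed.

Lemma is_derive_cst_fun c x : is_derive x 1 (fun=> c) 0.
Proof. exact: is_derive_cst. Qed.

Lemma is_derive_comp_fun f g x a b :
  is_derive (g x) 1 f a -> is_derive x 1 g b ->
  is_derive x 1 (fun y => f (g y)) (a * b).
Proof. by move=> ? ?; exact: is_derive1_comp. Qed.

Lemma is_derive_continuous f x l : is_derive x 1 f l -> {for x, continuous f}.
Proof.
by case=> df _; apply: differentiable_continuous; apply/derivable1_diffP.
Qed.

Lemma continuous_cst_fun c : continuous (fun _ : R => c).
Proof. by move=> x; exact: cvg_cst. Qed.

Lemma continuousD_fun f g : continuous f -> continuous g ->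
  continuous (fun x => f x + g x).
Proof. by move=> cf cg x; apply: cvgD; [exact: cf|exact: cg]. Qed.

Lemma continuousB_fun f g : continuous f -> continuous g ->
  continuous (fun x => f x - g x).
Proof. by move=> cf cg x; apply: cvgB; [exact: cf|exact: cg]. Qed.

Lemma continuousN_fun f : continuous f -> continuous (fun x => - f x).
Proof. by move=> cf x; apply: cvgN; exact: cf. Qed.

Lemma continuousM_fun f g : continuous f -> continuous g ->
  continuous (fun x => f x * g x).
Proof. by move=> cf cg x; apply: cvgM; [exact: cf|exact: cg]. Qed.

End RealCalculus.

(* Syntactic comparison: trying to convert unrelated transcendental functions
   would unfold them. *)
Ltac same_value f g z :=
  let a := eval cbv beta in (f z) in
  let b := eval cbv beta in (g z) in constr_eq a b.

(* Differentiates an arithmetic expression, leaving the derivatives of its atoms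
   to the context. *)
Ltac derive_expr :=
  lazymatch goal with
  | |- is_derive _ _ (fun x => @GRing.add _ (@?f x) (GRing.opp (@?g x))) _ =>
      eapply (is_deriveB_fun f g); derive_expr
  | |- is_derive _ _ (fun x => @GRing.add _ (@?f x) (@?g x)) _ =>
      eapply (is_deriveD_fun f g); derive_expr
  | |- is_derive _ _ (fun x => @GRing.mul _ (@?f x) (@?g x)) _ =>
      eapply (is_deriveM_fun f g); derive_expr
  | |- is_derive _ _ (fun x => @GRing.opp _ (@?f x)) _ =>
      eapply (is_deriveN_fun f); derive_expr
  | |- is_derive _ _ (fun x => x) _ => apply: is_derive_id
  | |- is_derive _ _ (fun x => sin x) _ => apply: is_derive_sin
  | |- is_derive _ _ (fun x => cos x) _ => apply: is_derive_cos
  | |- is_derive ?z _ ?g _ =>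
      first [match goal with
             | H : is_derive z _ ?f _ |- _ => same_value f g z; exact H
             | H : forall t, is_derive t _ ?f (@?d t) |- _ =>
                 same_value f g z; exact (H z)
             end
            |apply: is_derive_cst_fun]
  end.

Ltac derive_to := eapply is_derive_eq; [derive_expr|].

Ltac continuity_expr :=
  lazymatch goal with
  | |- continuous (fun x => @GRing.add _ (@?f x) (GRing.opp (@?g x))) =>
      apply: (continuousB_fun f g); continuity_expr
  | |- continuous (fun x => @GRing.add _ (@?f x) (@?g x)) =>
      apply: (continuousD_fun f g); continuity_expr
  | |- continuous (fun x => @GRing.mul _ (@?f x) (@?g x)) =>
      apply: (continuousM_fun f g); continuity_expr
  | |- continuous (fun x => @GRing.opp _ (@?f x)) =>
      apply: (continuousN_fun f); continuity_expr
  | |- continuous (fun x => sin x) => exact: continuous_sin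
  | |- continuous (fun x => cos x) => exact: continuous_cos
  | |- continuous (fun x => x) => by move=> ?; exact: cvg_id
  | |- continuous ?g =>
      let z := fresh "z" in move=> z;
      first [match goal with H : continuous ?f |- _ =>
               same_value f g z; exact (H z) end
            |exact: continuous_cst_fun]
  end.


Section Integrals.
Context {R : realType}.
Notation mu := (@lebesgue_measure R).
Implicit Types (f g F : R -> R) (a b c x : R).

Lemma continuous_itv_integrable f a b : {within `[a, b], continuous f} ->
  mu.-integrable `[a, b] (EFin \o f).
Proof.
by move=> cf; apply: continuous_compact_integrable => //; exact: segment_compact.
Qed.

Lemma integrable_continuous f a b : continuous f ->
  mu.-integrable `[a, b] (EFin \o f).
Proof. by move=> cf; exact/continuous_itv_integrable/continuous_subspaceT. Qed.

Lemma Rint_D f g a b : continuous f -> continuous g ->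
  \int[mu]_(x in `[a, b]) (f x + g x) =
  \int[mu]_(x in `[a, b]) f x + \int[mu]_(x in `[a, b]) g x.
Proof. by move=> cf cg; rewrite RintegralD//; exact: integrable_continuous. Qed.

Lemma Rint_B f g a b : continuous f -> continuous g ->
  \int[mu]_(x in `[a, b]) (f x - g x) =
  \int[mu]_(x in `[a, b]) f x - \int[mu]_(x in `[a, b]) g x.
Proof. by move=> cf cg; rewrite RintegralB//; exact: integrable_continuous. Qed.

Lemma Rint_Zl k f a b : continuous f ->
  \int[mu]_(x in `[a, b]) (k * f x) = k * \int[mu]_(x in `[a, b]) f x.
Proof. by move=> cf; rewrite RintegralZl//; exact: integrable_continuous. Qed.

Lemma Rint_le f g a b : {within `[a, b], continuous f} ->
  {within `[a, b], continuous g} ->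
  (forall x, a <= x <= b -> f x <= g x) ->
  \int[mu]_(x in `[a, b]) f x <= \int[mu]_(x in `[a, b]) g x.
Proof.
move=> cf cg fg; apply: le_Rintegral => //; try exact: continuous_itv_integrable.
Qed.

Lemma Rint_FTC F f a b : a <= b -> {within `[a, b], continuous f} ->
  (forall x, a <= x <= b -> is_derive x 1 F (f x)) ->
  \int[mu]_(x in `[a, b]) f x = F b - F a.
Proof.
rewrite le_eqVlt => /predU1P[->|ab] cf dF.
  by rewrite set_itv1 Rintegral_set1 subrr.
rewrite /Rintegral (continuous_FTC2 ab cf (F := F))//.
- split.
  + move=> x; rewrite in_itv/= => /andP[/ltW ax /ltW xb].
    by have [] : is_derive x 1 F (f x) by apply: dF; rewrite ax.
  + apply: cvg_at_right_filter; apply: (@is_derive_continuous _ F _ (f a)).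
    by apply: dF; rewrite lexx ltW.
  + apply: cvg_at_left_filter; apply: (@is_derive_continuous _ F _ (f b)).
    by apply: dF; rewrite lexx ltW.
- move=> x; rewrite in_itv/= => /andP[/ltW ax /ltW xb]; rewrite derive1E.
  by have [_ ->] : is_derive x 1 F (f x) by apply: dF; rewrite ax.
Qed.

Lemma Rint_chasles f a b c : continuous f -> a <= b -> b <= c ->
  \int[mu]_(x in `[a, c]) f x =
  \int[mu]_(x in `[a, b]) f x + \int[mu]_(x in `[b, c]) f x.
Proof.
move=> cf ab bc.
have := @Rintegral_itvB R f (BLeft a) (BRight c) b (integrable_continuous _ _ _ cf).
rewrite !bnd_simp ab bc => /(_ isT isT) /eqP; rewrite subr_eq addrC => /eqP ->.
rewrite Rintegral_itv_obnd_cbnd//.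
apply: integrableS (integrable_continuous f b c cf) => //.
exact: subset_itv_oc_cc.
Qed.

Lemma Rint_translate f a b T : a <= b -> continuous f ->
  \int[mu]_(x in `[a + T, b + T]) f x = \int[mu]_(x in `[a, b]) f (x + T).
Proof.
move=> ab cf; rewrite /Rintegral.
have dT x : is_derive x 1 (fun y : R => y + T) 1 by derive_to; rewrite addr0.
have dT1 : derive1 (fun y : R => y + T) = cst 1.
  by apply/funext => x; rewrite derive1E; case: (dT x).
have cT x : {for x, continuous (fun y : R => y + T)}.
  by apply: is_derive_continuous; exact: dT.
have /= -> := @integration_by_substitution_increasing R (fun x => x + T) f a b ab.
- by congr fine; apply: eq_integral => x _; rewrite dT1 /= !fctE mulr1.
- by move=> x y _ _ xy; rewrite ltrD2r.
- by rewrite dT1 => x _; exact: cvg_cst.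
- by rewrite dT1; exact: is_cvg_cst.
- by rewrite dT1; exact: is_cvg_cst.
- split.
  + by move=> x _; case: (dT x).
  + by apply: cvg_at_right_filter; exact: cT.
  + by apply: cvg_at_left_filter; exact: cT.
- exact: continuous_subspaceT.
Qed.

Lemma Rint_periodic f T z : continuous f -> periodic f T -> 0 <= z <= T ->
  \int[mu]_(x in `[z, z + T]) f x = \int[mu]_(x in `[0, T]) f x.
Proof.
move=> cf pf /andP[z0 zT]; have T0 := le_trans z0 zT.
rewrite (Rint_chasles f z T)// ?lerDr//.
rewrite -{2}(add0r T) Rint_translate// (Rint_chasles f 0 z T)// addrC.
by congr +%R; apply: eq_Rintegral => x _; rewrite pf.
Qed.

Lemma Rint_eq0 f a b : a < b -> continuous f ->
  (forall x, a <= x <= b -> 0 <= f x) ->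
  \int[mu]_(x in `[a, b]) f x = 0 -> forall x, a <= x <= b -> f x = 0.
Proof.
move=> ab cf f0 If x axb; apply/eqP; rewrite eq_le f0// andbT leNgt.
apply/negP => fx0.
have /cvgrPdist_lt/(_ (f x / 2)) : f y @[y --> x] --> f x by exact: cf.
rewrite divr_gt0// => /(_ isT)/nbhs_ballP[d /= d0 fd].
pose c := Num.max a (x - d / 2); pose e := Num.min b (x + d / 2).
have [ax xb] := andP axb.
have d2 : 0 < d / 2 by rewrite divr_gt0.
have ac : a <= c by rewrite le_max lexx.
have eb : e <= b by rewrite ge_min lexx.
have ce : c < e.
  by rewrite gt_max !lt_min ab/=; repeat (apply/andP; split); lra.
have ice : f x / 2 * (e - c) <= \int[mu]_(x in `[c, e]) f x.
  have <- : \int[mu]_(y in `[c, e]) (f x / 2) = f x / 2 * (e - c).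
    by rewrite Rintegral_cst//= lebesgue_measure_itv/= lte_fin ce.
  apply: Rint_le.
  - by apply: continuous_subspaceT => ?; exact: cvg_cst.
  - exact: continuous_subspaceT.
  - move=> y; rewrite ge_max le_min -!andbA => /and4P[ay yd yb yd'].
    have /fd/= : ball x d y.
      by rewrite /ball/= ltr_norml; apply/andP; split; lra.
    by rewrite ltr_norml => /andP[]; lra.
have [ca cb] : a <= e /\ c <= b by split; lra.
have := If; rewrite (Rint_chasles f a c b)// (Rint_chasles f c e b)//; last exact: ltW.
have i1 : 0 <= \int[mu]_(x in `[a, c]) f x.
  apply: Rintegral_ge0 => y /=; rewrite in_itv/= => /andP[? ?]; apply: f0; lra.
have i2 : 0 <= \int[mu]_(x in `[e, b]) f x.
  apply: Rintegral_ge0 => y /=; rewrite in_itv/= => /andP[? ?]; apply: f0; lra.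
have m0 : 0 < f x / 2 * (e - c) by rewrite mulr_gt0// ?subr_gt0// divr_gt0.
move=> H; suff : (0 : R) < 0 by rewrite ltxx.
rewrite -[X in _ < X]H; apply: ltr_wpDl => //; apply: ltr_pwDl => //.
exact: lt_le_trans ice.
Qed.

End Integrals.

(** * Wirtinger's inequality on arcs *)

Section Wirtinger.
Context {R : realType}.
Notation mu := (@lebesgue_measure R).
Implicit Types (f : R -> R).

Lemma derivable_continuous f (f1 : R -> R) : (forall x : R, is_derive x 1 f (f1 x)) ->
  continuous f.
Proof. by move=> df x; exact: is_derive_continuous (df x). Qed.

Lemma within_continuous_tan (a b : R) (l c : R) :
  (forall x, a <= x <= b -> cos (l * (x - c)) != 0) ->
  {within `[a, b], continuous (fun x => tan (l * (x - c)))}.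
Proof.
move=> cn0; apply: continuous_in_subspaceT => x.
rewrite inE/= in_itv/= => axb.
apply: (@is_derive_continuous _ _ _ ((cos (l * (x - c))) ^- 2 * l)).
apply: is_derive_comp_fun; first exact/is_derive_tan/cn0.
by derive_to; ring.
Qed.

(** With [t = tan (l (x - c))] centred at the midpoint, adding the exact derivative
    of [l f^2 t] to [f1^2 - l^2 f^2] completes the square [(f1 + l f t)^2]; the
    factor [l < 1] keeps the tangent finite up to the endpoints. *)
Lemma wirtinger_scaled f (f1 : R -> R) (a b l : R) : a <= b -> b - a <= pi ->
  0 < l < 1 -> (forall x : R, is_derive x 1 f (f1 x)) -> continuous f1 ->
  f a = 0 -> f b = 0 ->
  l ^+ 2 * \int[mu]_(x in `[a, b]) (f x * f x) <=
  \int[mu]_(x in `[a, b]) (f1 x * f1 x).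
Proof.
move=> ab abpi /andP[l0 l1] df cf1 fa fb; have cf := derivable_continuous _ _ df.
pose c := (a + b) / 2; pose t x := tan (l * (x - c)).
have pi0 := pi_gt0 R.
have cn0 x : a <= x <= b -> cos (l * (x - c)) != 0.
  move=> /andP[ax xb]; apply/lt0r_neq0/cos_gt0_pihalf.
  have xc : `|x - c| <= pi / 2.
    by rewrite ler_norml /c; apply/andP; split; lra.
  rewrite -ltr_norml normrM (gtr0_norm l0).
  have [->|xc0] := eqVneq (x - c) 0; first by rewrite normr0 mulr0 divr_gt0.
  by apply: lt_le_trans xc; rewrite gtr_pMl ?normr_gt0.
have dt x : a <= x <= b -> is_derive x 1 t (l * (1 + t x * t x)).
  move=> axb; rewrite [l * _]mulrC -expr2 /t.
  have -> : 1 + tan (l * (x - c)) ^+ 2 = (cos (l * (x - c))) ^- 2.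
    by rewrite (@cos2_tan2 _ (l * (x - c)))// ?cn0// invrK.
  apply: is_derive_comp_fun; first exact/is_derive_tan/cn0.
  by derive_to; ring.
have ct : {within `[a, b], continuous t} by exact: within_continuous_tan.
pose T x := l * (f x * f x) * t x.
pose T' x := l * (f x * f1 x + f1 x * f x) * t x
             + l * (f x * f x) * (l * (1 + t x * t x)).
have dT x : a <= x <= b -> is_derive x 1 T (T' x).
  move=> /dt dtx; rewrite /T /T'; derive_to; ring.
have cT' : {within `[a, b], continuous T'}.
  have cc (g : R -> R) : continuous g -> {within `[a, b], continuous g}.
    exact: continuous_subspaceT.
  move=> x; apply: (@cvgD _ _ _ (nbhs (x : subspace `[a, b]))).
    apply: cvgM; last exact: ct.
    by apply: (cc (fun x => l * (f x * f1 x + f1 x * f x))); continuity_expr.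
  apply: cvgM; first by apply: (cc (fun x => l * (f x * f x))); continuity_expr.
  apply: cvgM; first exact: cvg_cst.
  by apply: cvgD; [exact: cvg_cst|apply: cvgM; exact: ct].
have iT' : \int[mu]_(x in `[a, b]) T' x = 0.
  by rewrite (Rint_FTC T)// /T fa fb; ring.
have cff : continuous (fun x => l ^+ 2 * (f x * f x)) by continuity_expr.
have cf11 : continuous (fun x => f1 x * f1 x) by continuity_expr.
rewrite -Rint_Zl; last by continuity_expr.
rewrite -subr_ge0 -Rint_B// -oppr0 -iT'.
have -> : - (\int[mu]_(x in `[a, b]) T' x) = \int[mu]_(x in `[a, b]) (-1 * T' x).
  by rewrite RintegralZl ?mulN1r//; exact: continuous_itv_integrable.
apply: Rint_le.
- move=> x; apply: (@cvgM _ _ (nbhs (x : subspace `[a, b]))); first exact: cvg_cst.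
  exact: cT'.
- by apply: continuous_subspaceT; continuity_expr.
- move=> x _; rewrite -subr_ge0.
  rewrite [leRHS](_ : _ = (f1 x + l * f x * t x) ^+ 2) ?sqr_ge0//.
  by rewrite /T'; ring.
Qed.

(** The scaled inequality holds for all [l < 1], hence in the limit. *)
Lemma wirtinger f (f1 : R -> R) (a b : R) : a <= b -> b - a <= pi ->
  (forall x : R, is_derive x 1 f (f1 x)) -> continuous f1 ->
  f a = 0 -> f b = 0 ->
  \int[mu]_(x in `[a, b]) (f x * f x) <= \int[mu]_(x in `[a, b]) (f1 x * f1 x).
Proof.
move=> ab abpi df cf1 fa fb.
have := fun l l01 => wirtinger_scaled f f1 a b l ab abpi l01 df cf1 fa fb.
have : 0 <= \int[mu]_(x in `[a, b]) (f1 x * f1 x).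
  by apply: Rintegral_ge0 => x _; rewrite -expr2 sqr_ge0.
move: (\int[mu]_(x in _) _) (\int[mu]_(x in _) (f x * f x)) => B A B0 H.
rewrite leNgt; apply/negP => BA.
have A0 : 0 < A by exact: le_lt_trans BA.
(* chosen so that [(1 - 2 e) A] is the midpoint of [A] and [B] *)
pose e := (A - B) / (4 * A).
have eA : e * (4 * A) = A - B by rewrite /e divfK// mulf_neq0// gt_eqF.
have e0 : 0 < e by rewrite divr_gt0 ?subr_gt0// mulr_gt0.
have e1 : e < 1 by nra.
have /H : 0 < 1 - e < 1 by apply/andP; split; lra.
by nra.
Qed.

(** From a zero [z], take the last zero [w] before [z + pi] and the first zero [w']
    after it: a gap [w' - w > pi] would contain a half circle free of zeros. The three
    points then cut the circle into arcs to which [wirtinger] applies. *)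
Lemma three_zeros f : continuous f -> periodic f (2 * pi) ->
  (forall th : R, exists z, th <= z <= th + pi /\ f z = 0) ->
  exists z w w' : R, [/\ 0 <= z <= 2 * pi, z <= w <= z + pi,
    z + pi <= w' <= z + 2 * pi, w' - w <= pi & [/\ f z = 0, f w = 0 & f w' = 0]].
Proof.
move=> cf pf Hz; have pi0 := pi_gt0 R.
have cptZ a b : compact [set x | a <= x <= b /\ f x = 0].
  apply: (@subclosed_compact _ _ `[a, b]); last 2 first.
  - exact: segment_compact.
  - by move=> x [axb _]; rewrite /= in_itv.
  rewrite [X in closed X](_ : _ = `[a, b] `&` f @^-1` [set 0]).
    apply: closedI; first exact: interval_closed.
    by apply: closed_comp => [x _|]; [exact: cf|exact: closed_eq].
  by apply/seteqP; split => x /=; rewrite in_itv.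
have cid (A : set R) : {within A, continuous (@idfun R)}.
  by apply: continuous_subspaceT => x; exact: cvg_id.
have [z [/andP[z0 zpi] fz]] := Hz 0.
have [|w] := compact_EVT_max (f := idfun) _ (cptZ z (z + pi)) (cid _).
  by exists z; split => //; rewrite lexx lerDl ltW.
rewrite inE => -[zw fw] wmax.
have [|w'] := compact_EVT_min (f := idfun) _ (cptZ (z + pi) (z + pi + pi)) (cid _).
  by have [y ?] := Hz (z + pi); exists y.
rewrite inE => -[zw' fw'] wmin.
have E : z + pi + pi = z + 2 * pi by ring.
exists z, w, w'; split => //; first by apply/andP; split; lra.
  by rewrite -E.
rewrite leNgt; apply/negP => gap.
have [y [/andP[ly yr] fy]] := Hz (w + (w' - w - pi) / 2).
have [yz|zy] := leP y (z + pi).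
  have : y <= w by apply: wmax; rewrite inE; split => //; apply/andP; split; lra.
  lra.
have : w' <= y.
  apply: wmin; rewrite inE; split => //; apply/andP; split; [exact: ltW|lra].
lra.
Qed.

End Wirtinger.

(** * Periodic profiles and their integrals over the circle *)

Section CircleIntegral.
Context {R : realType}.
Notation mu := (@lebesgue_measure R).
Implicit Types (f g F : R -> R).

Definition circ_int f : R := \int[mu]_(th in `[0, 2 * pi]) f th.

Lemma twopi_gt0 : 0 < 2 * pi :> R.
Proof. by rewrite mulr_gt0// pi_gt0. Qed.

Lemma circ_intD f g : continuous f -> continuous g ->
  circ_int (fun th => f th + g th) = circ_int f + circ_int g.
Proof. exact: Rint_D. Qed.

Lemma circ_intB f g : continuous f -> continuous g ->
  circ_int (fun th => f th - g th) = circ_int f - circ_int g.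
Proof. exact: Rint_B. Qed.

Lemma circ_intZ k f : continuous f ->
  circ_int (fun th => k * f th) = k * circ_int f.
Proof. exact: Rint_Zl. Qed.

Lemma circ_int_ge0 f : (forall th, 0 <= f th) -> 0 <= circ_int f.
Proof. by move=> f0; apply: Rintegral_ge0. Qed.

Lemma eq_circ_int f g : f =1 g -> circ_int f = circ_int g.
Proof. by move=> fg; apply: eq_Rintegral => x _; exact: fg. Qed.

Lemma circ_int_eq0 f : continuous f -> (forall th, 0 <= f th) ->
  circ_int f = 0 -> forall th, 0 <= th <= 2 * pi -> f th = 0.
Proof. by move=> cf f0; apply: Rint_eq0 => //; exact: twopi_gt0. Qed.

Lemma circ_int_derive F f : (forall th : R, is_derive th 1 F (f th)) ->
  continuous f -> periodic F (2 * pi) -> circ_int f = 0.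
Proof.
move=> dF cf pF; rewrite /circ_int (Rint_FTC F)//; last first.
- exact: continuous_subspaceT.
- exact/ltW/twopi_gt0.
by rewrite -[2 * pi]add0r pF subrr.
Qed.

Lemma periodic_derive F f T : (forall x : R, is_derive x 1 F (f x)) ->
  periodic F T -> periodic f T.
Proof.
move=> dF pF x.
have d1 : is_derive x 1 (fun y => F (y + T)) (f (x + T)).
  rewrite -[f _]mulr1; apply: is_derive_comp_fun => //.
  by derive_to; ring.
have E : (fun y => F (y + T)) = F by apply/funext => y; exact: pF.
by rewrite E in d1; case: d1 (dF x) => _ <- [_ <-].
Qed.

Lemma periodic_circle f x : periodic f (2 * pi) ->
  exists2 y, 0 <= y <= 2 * pi & f x = f y.
Proof.
move=> pf; have T0 := twopi_gt0.
pose k := Num.floor (x / (2 * pi)).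
have pz (m : int) y : f (y + (2 * pi) *~ m) = f y.
  case: m => n; first by rewrite -pmulrn (periodicn pf).
  rewrite NegzE mulrNz -pmulrn.
  by rewrite -[in RHS](subrK ((2 * pi) *+ n.+1) y) (periodicn pf).
exists (x - (2 * pi) *~ k); last by rewrite -mulrNz pz.
have kx : k%:~R <= x / (2 * pi) by exact: ge_floor.
have xk : x / (2 * pi) < (k + 1)%:~R by exact: floorD1_gt.
rewrite -mulrzr subr_ge0 lerBlDr.
have -> : 2 * pi + 2 * pi * k%:~R = (k + 1)%:~R * (2 * pi) :> R.
  by rewrite intrD; ring.
by rewrite mulrC -ler_pdivlMr// kx/= -ler_pdivrMr// ltW.
Qed.

End CircleIntegral.

Section SupportC2.
Context {R : realType}.
Implicit Types (f h k S T : R -> R).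

(** The equation [h'' + h = S] as a first-order system; for a support function, [S]
    is the curvature radius. Differences of support functions, such as [h - r k], are
    solutions as well. *)
Record support_C2 (h h1 S : R -> R) : Prop := SupportC2 {
  support_derive : forall th : R, is_derive th 1 h (h1 th);
  support_derive1 : forall th : R, is_derive th 1 h1 (S th - h th);
  radius_continuous : continuous S;
  support_periodic : periodic h (2 * pi) }.

Section Theory.
Variables (h h1 S k k1 T : R -> R).
Hypotheses (hh : support_C2 h h1 S) (hk : support_C2 k k1 T).

Lemma support_continuous : continuous h.
Proof. exact: derivable_continuous (support_derive _ _ _ hh). Qed.

Lemma support1_continuous : continuous h1.
Proof. exact: derivable_continuous (support_derive1 _ _ _ hh). Qed.

Lemma support1_periodic : periodic h1 (2 * pi).
Proof.
exact: periodic_derive (support_derive _ _ _ hh) (support_periodic _ _ _ hh).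
Qed.

Lemma radius_periodic : periodic S (2 * pi).
Proof.
have := periodic_derive _ _ _ (support_derive1 _ _ _ hh) support1_periodic.
by move=> pS x; have := pS x; rewrite (support_periodic _ _ _ hh) => /addIr.
Qed.

Lemma support_C2_lin (a b : R) :
  support_C2 (fun th => a * h th + b * k th) (fun th => a * h1 th + b * k1 th)
    (fun th => a * S th + b * T th).
Proof.
have [dh dh1 cS ph] := hh; have [dk dk1 cT pk] := hk; split.
- by move=> th; derive_to; ring.
- by move=> th; derive_to; ring.
- by continuity_expr.
- by move=> th; rewrite ph pk.
Qed.

(** Integrating twice by parts around the circle, [h''] may be moved onto the
    other factor; this is the symmetry of the mixed area. *)
Lemma circ_int_sym :
  circ_int (fun th => h th * T th) = circ_int (fun th => k th * S th).
Proof.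
have [dh dh1 cS ph] := hh; have [dk dk1 cT pk] := hk.
have ch := support_continuous; have ck := derivable_continuous _ _ dk.
have ch1 := support1_continuous; have ck1 := derivable_continuous _ _ dk1.
have pk1 := periodic_derive _ _ _ dk pk; have ph1 := support1_periodic.
apply/eqP; rewrite -subr_eq0 -circ_intB; [apply/eqP|by continuity_expr..].
apply: (circ_int_derive (fun th => h th * k1 th - k th * h1 th)).
- by move=> th; derive_to; ring.
- by continuity_expr.
- by move=> th; rewrite ph pk ph1 pk1.
Qed.

End Theory.

Lemma trig_C2 (a b : R) :
  support_C2 (fun th => a * cos th + b * sin th)
    (fun th => b * cos th - a * sin th) (fun=> 0).
Proof.
split.
- by move=> th; derive_to; ring.
- by move=> th; derive_to; ring.
- by move=> ?; exact: cvg_cst.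
- by move=> th; rewrite !mulr_natl cosD2pi sinD2pi.
Qed.

(** Cutting the circle at three zeros into arcs of length at most [pi], the
    quantity is minus the sum of the Wirtinger deficits of the arcs. *)
Lemma wirtinger_circle f f1 S : support_C2 f f1 S ->
  (forall th : R, exists z, th <= z <= th + pi /\ f z = 0) ->
  circ_int (fun th => f th * S th) <= 0.
Proof.
move=> hf zf; have [df df1 cS pf] := hf.
have cf := support_continuous _ _ _ hf; have cf1 := support1_continuous _ _ _ hf.
have pf1 := support1_periodic _ _ _ hf.
have cff : continuous (fun th => f th * f th) by continuity_expr.
have cff1 : continuous (fun th => f1 th * f1 th) by continuity_expr.
have E : circ_int (fun th => f th * S th) =
    circ_int (fun th => f th * f th) - circ_int (fun th => f1 th * f1 th).
  rewrite -circ_intB//; apply/eqP; rewrite -subr_eq0.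
  rewrite -circ_intB; [apply/eqP|by continuity_expr..].
  apply: (circ_int_derive (fun th => f th * f1 th)).
  - by move=> th; derive_to; ring.
  - by continuity_expr.
  - by move=> th; rewrite pf pf1.
have [z [w [w' [z02 /andP[zw wz] /andP[zw' w'z] gap [fz fw fw']]]]] :=
  three_zeros f cf pf zf.
have fz2 : f (z + 2 * pi) = 0 by rewrite pf.
have ww' : w <= w' by exact: le_trans zw'.
have split3 g : continuous g -> periodic g (2 * pi) -> circ_int g =
    \int[lebesgue_measure]_(x in `[z, w]) g x
    + (\int[lebesgue_measure]_(x in `[w, w']) g x
      + \int[lebesgue_measure]_(x in `[w', z + 2 * pi]) g x).
  move=> cg pg; rewrite /circ_int -(Rint_periodic g _ z)//.
  have wz2 := le_trans ww' w'z.
  by rewrite (Rint_chasles g z w _ cg zw wz2) (Rint_chasles g w w' _ cg ww' w'z).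
rewrite E subr_le0 !split3//; first last.
- by move=> th; rewrite pf.
- by move=> th; rewrite pf1.
by rewrite lerD//; [|rewrite lerD//]; apply: wirtinger => //; lra.
Qed.

End SupportC2.

(** * Support functions and half-planes in the plane *)

Section PlaneGeometry.
Context {R : realType}.
Implicit Types (K L : set (R * R)%type) (p q : R * R) (h : R -> R) (th : R).

(** Asking for attained suprema makes the support function of a Minkowski sum or of a
    homothet a direct computation. *)
Definition supports K h := forall th,
  (forall p, K p -> inner2 p (udir th) <= h th) /\
  exists2 p, K p & inner2 p (udir th) = h th.

Lemma innerE p th : inner2 p (udir th) = p.1 * cos th + p.2 * sin th.
Proof. by []. Qed.

Lemma cos_periodic2 : periodic (@cos R) (2 * pi).
Proof. by rewrite mulr_natl; exact: cosD2pi. Qed.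

Lemma sin_periodic2 : periodic (@sin R) (2 * pi).
Proof. by rewrite mulr_natl; exact: sinD2pi. Qed.

Lemma polar_unit (a b : R) : a ^+ 2 + b ^+ 2 = 1 ->
  exists th, cos th = a /\ sin th = b.
Proof.
move=> ab; have a1 : -1 <= a <= 1 by apply/andP; split; nra.
have sa : Num.sqrt (1 - a ^+ 2) = `|b| by rewrite -ab addrC addKr sqrtr_sqr.
have [b0|b0] := leP 0 b.
  by exists (acos a); rewrite acosK ?in_itv// sin_acos// sa ger0_norm.
exists (- acos a); rewrite cosN sinN acosK ?in_itv// sin_acos// sa.
by rewrite ltr0_norm// opprK.
Qed.

Lemma polar (a b : R) : (a != 0) || (b != 0) ->
  exists r th, [/\ 0 < r, a = r * cos th & b = r * sin th].
Proof.
move=> ab0; set s := a ^+ 2 + b ^+ 2.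
have s0 : 0 < s.
  rewrite lt_neqAle addr_ge0 ?sqr_ge0// andbT eq_sym paddr_eq0 ?sqr_ge0//.
  by rewrite !sqrf_eq0 negb_and.
pose r := Num.sqrt s; have r0 : 0 < r by rewrite sqrtr_gt0.
have rs : r ^+ 2 = s by rewrite sqr_sqrtr// ltW.
have rn0 : r != 0 by rewrite gt_eqF.
have [|th [cth sth]] := polar_unit (a / r) (b / r).
  by rewrite !expr_div_n rs -mulrDl divff// gt_eqF.
by exists r, th; rewrite cth sth; split => //; rewrite mulrC divfK.
Qed.

Lemma convex_setE K : convex_set (M := (R * R)%type) K ->
  forall p q t, K p -> K q -> 0 <= t -> t <= 1 ->
  K (t * p.1 + (1 - t) * q.1, t * p.2 + (1 - t) * q.2).
Proof.
move=> cK p q t Kp Kq t0 t1.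
exact: set_mem (cK p q (Itv01 t0 t1) (mem_set Kp) (mem_set Kq)).
Qed.

Lemma convex_setP K :
  (forall p q t, K p -> K q -> 0 <= t -> t <= 1 ->
    K (t * p.1 + (1 - t) * q.1, t * p.2 + (1 - t) * q.2)) ->
  convex_set (M := (R * R)%type) K.
Proof.
move=> cK p q t; rewrite !inE => Kp Kq.
exact: cK p q t%:num Kp Kq (ge0 t) (le1 t).
Qed.

Lemma continuous_inner th : continuous (fun p : R * R => inner2 p (udir th)).
Proof.
by move=> p; apply: cvgD; apply: cvgM; do ?[exact: cvg_cst];
  [exact: cvg_fst|exact: cvg_snd].
Qed.

Lemma supports_unique K h k : supports K h -> supports K k -> h =1 k.
Proof.
move=> hK kK th; have [hU [p Kp ph]] := hK th; have [kU [q Kq qk]] := kK th.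
by apply/eqP; rewrite eq_le -{1}ph kU// -qk hU.
Qed.

Lemma compact_supports K : compact K -> K !=set0 -> supports K (support_fun K).
Proof.
move=> cK K0 th.
have [p] := compact_EVT_max K0 cK (continuous_subspaceT (continuous_inner th)).
rewrite inE => Kp pmax.
have hub : ubound [set inner2 x (udir th) | x in K] (inner2 p (udir th)).
  by move=> _ [q Kq <-]; apply: pmax; rewrite inE.
have E : support_fun K th = inner2 p (udir th).
  apply/eqP; rewrite eq_le; apply/andP; split.
    by apply: ge_sup => //; exists (inner2 p (udir th)), p.
  by apply: ub_le_sup; [exists (inner2 p (udir th))|exists p].
by split; [move=> q Kq; rewrite E; apply: pmax; rewrite inE|exists p].
Qed.

Lemma supports_periodic K h : supports K h -> periodic h (2 * pi).
Proof.
move=> hK th; apply/eqP; rewrite eq_le; apply/andP; split.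
  have [_ [p Kp <-]] := hK (th + 2 * pi); have [U _] := hK th.
  by have := U p Kp; rewrite !innerE cos_periodic2 sin_periodic2.
have [_ [p Kp <-]] := hK th; have [U _] := hK (th + 2 * pi).
by have := U p Kp; rewrite !innerE cos_periodic2 sin_periodic2.
Qed.

Lemma compact_coord_bounded K : compact K ->
  exists2 C, 0 < C & forall p, K p -> `|p.1| <= C /\ `|p.2| <= C.
Proof.
move=> cK; have [K0|K0] := pselect (K !=set0); last first.
  by exists 1 => // p Kp; case: K0; exists p.
have cN : continuous (fun p : R * R => p.1 ^+ 2 + p.2 ^+ 2).
  by move=> p; apply: cvgD; apply: cvgM; (exact: cvg_fst || exact: cvg_snd).
have [c _ cmax] := compact_EVT_max K0 cK (continuous_subspaceT cN).
have s0 (x : R) := sqr_ge0 x.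
exists (c.1 ^+ 2 + c.2 ^+ 2 + 1).
  by rewrite ltr_wpDl// addr_ge0.
move=> p Kp; have := cmax p; rewrite inE => /(_ Kp) H.
have := s0 p.1; have := s0 p.2; move: H; set C := c.1 ^+ 2 + c.2 ^+ 2.
by move=> *; rewrite !ler_norml; split; apply/andP; split; nra.
Qed.

(** The direction from the nearest point of [K] to [p] separates. *)
Lemma separation K p : compact K -> K !=set0 ->
  convex_set (M := (R * R)%type) K -> ~ K p ->
  exists th, forall q, K q -> inner2 q (udir th) < inner2 p (udir th).
Proof.
move=> cK K0 /convex_setE vK nKp.
pose N (q : R * R) := (p.1 - q.1) ^+ 2 + (p.2 - q.2) ^+ 2.
have cN : continuous N.
  by move=> q; apply: cvgD; apply: cvgM; apply: cvgB; do ?[exact: cvg_cst];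
    (exact: cvg_fst || exact: cvg_snd).
have [c + cmin] := compact_EVT_min K0 cK (continuous_subspaceT cN).
rewrite inE => Kc.
have [|r [th [r0 v1 v2]]] := polar (p.1 - c.1) (p.2 - c.2).
  rewrite -negb_and !subr_eq0; apply/negP => /andP[/eqP p1 /eqP p2].
  by apply: nKp; move: p c p1 p2 Kc {N cN cmin} => [? ?] [? ?] /= -> ->.
exists th => q Kq; rewrite !innerE.
set w1 := q.1 - c.1; set w2 := q.2 - c.2.
pose vw := (p.1 - c.1) * w1 + (p.2 - c.2) * w2.
suff vw0 : vw <= 0.
  have : (p.1 - c.1) * cos th + (p.2 - c.2) * sin th = r.
    by rewrite v1 v2 -[RHS]mulr1 -(cos2Dsin2 th); ring.
  have : vw = r * (w1 * cos th + w2 * sin th) by rewrite /vw v1 v2; ring.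
  move=> E; move: vw0; rewrite E pmulr_rle0//.
  by rewrite /w1 /w2; lra.
rewrite leNgt; apply/negP => vw0.
pose n := w1 ^+ 2 + w2 ^+ 2.
have n0 : 0 <= n by rewrite addr_ge0 ?sqr_ge0.
(* a step below [vw / n], up to which the squared distance decreases *)
pose t := vw / (vw + n).
have d0 : 0 < vw + n by rewrite ltr_pwDl.
have t0 : 0 < t by rewrite divr_gt0.
have t1 : t <= 1 by rewrite ler_pdivrMr// mul1r lerDl.
have tn : t * (vw + n) = vw by rewrite divfK// gt_eqF.
have := cmin _ (mem_set (vK q c t Kq Kc (ltW t0) t1)).
rewrite /N/= => H.
have : 0 <= t * (t * n - 2 * vw).
  by move: H; rewrite /n /vw /w1 /w2 -subr_ge0; congr (0 <= _); ring.
rewrite pmulr_rge0//.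
have : 0 < t * vw by rewrite mulr_gt0.
lra.
Qed.

(** A point outside [K] violates the half-plane given by [separation]. *)
Lemma halfplanes K h p : compact K -> convex_set (M := (R * R)%type) K ->
  supports K h -> (forall th, inner2 p (udir th) <= h th) -> K p.
Proof.
move=> cK vK hK ph; apply: contrapT => nKp.
have K0 : K !=set0 by have [_ [q Kq _]] := hK 0; exists q.
have [th H] := separation K p cK K0 vK nKp.
have [_ [q /H + E]] := hK th; rewrite E => /lt_le_trans/(_ (ph th)).
by rewrite ltxx.
Qed.

Lemma supports_continuous K h : compact K -> supports K h -> continuous h.
Proof.
move=> cK hK th; have [C C0 HC] := compact_coord_bounded K cK.
pose D t := C * (`|cos th - cos t| + `|sin th - sin t|).
have one t s : h t - h s <= C * (`|cos t - cos s| + `|sin t - sin s|).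
  have [_ [p Kp <-]] := hK t; have [/(_ p Kp) U _] := hK s.
  have [p1 p2] := HC p Kp.
  apply: (@le_trans _ _ (p.1 * (cos t - cos s) + p.2 * (sin t - sin s))).
    by move: U; rewrite !innerE; lra.
  by rewrite [leRHS]mulrDr lerD// (le_trans (ler_norm _))// normrM ler_wpM2r//.
have hD t : `|h th - h t| <= D t.
  rewrite ler_norml lerNl opprB one andbT /D.
  by rewrite (distrC (cos th)) (distrC (sin th)) one.
have cD : D t @[t --> th] --> (0 : R).
  have -> : (0 : R) = D th by rewrite /D !subrr normr0 addr0 mulr0.
  apply: cvgM; first exact: cvg_cst.
  by apply: cvgD; apply: cvg_norm; apply: cvgB; do ?[exact: cvg_cst];
    (exact: continuous_cos || exact: continuous_sin).
apply/cvgrPdist_lt => e e0; have /cvgrPdist_lt/(_ e e0) := cD.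
apply: filterS => t; rewrite sub0r normrN; apply: le_lt_trans.
exact: le_trans (hD t) (ler_norm _).
Qed.

Lemma supports_min K h p : compact K -> supports K h ->
  (forall th, inner2 p (udir th) < h th) ->
  exists2 m, 0 < m & forall th, inner2 p (udir th) + m <= h th.
Proof.
move=> cK hK ph; pose g th := h th - inner2 p (udir th).
have ch := supports_continuous _ _ cK hK.
have cg : continuous g by rewrite /g /inner2 /=; continuity_expr.
have [c _ cmin] := EVT_min (ltW (@twopi_gt0 R)) (continuous_subspaceT cg).
exists (g c); first by rewrite subr_gt0.
have pg : periodic g (2 * pi).
  move=> th; rewrite /g (supports_periodic _ _ hK) !innerE.
  by rewrite cos_periodic2 sin_periodic2.
move=> th; rewrite addrC -lerBrDr; have [y y02] := periodic_circle g th pg.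
by rewrite -/(g th) => ->; apply: cmin; rewrite in_itv.
Qed.

Lemma coord_bound (x y c s e : R) : `|x| <= e -> `|y| <= e -> c ^+ 2 + s ^+ 2 = 1 ->
  x * c + y * s <= 2 * e.
Proof.
move=> xe ye cs; have e0 : 0 <= e by exact: le_trans xe.
have c1 : `|c| <= 1 by rewrite ler_norml; apply/andP; split; nra.
have s1 : `|s| <= 1 by rewrite ler_norml; apply/andP; split; nra.
rewrite mulr_natl mulr2n lerD// (le_trans (ler_norm _))// normrM -[e]mulr1.
  by rewrite ler_pM.
by rewrite ler_pM.
Qed.

(** Otherwise [h - <p, u>] has a positive minimum, and a small square around
    [p] satisfies all the half-plane constraints. *)
Lemma boundary_supported K h p : compact K -> convex_set (M := (R * R)%type) K ->
  supports K h -> K p -> ~ K° p -> exists th, inner2 p (udir th) = h th.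
Proof.
move=> cK vK hK Kp nKp; apply: contrapT => np.
have ph th : inner2 p (udir th) < h th.
  have [/(_ p Kp) + _] := hK th; rewrite le_eqVlt => /predU1P[E|//].
  by case: np; exists th.
have [m m0 Hm] := supports_min _ _ _ cK hK ph.
apply: nKp; apply/nbhs_ballP; exists (m / 2); first by rewrite /= divr_gt0.
move=> q [/ltW q1 /ltW q2]; apply: (halfplanes K h) => // th.
have := Hm th; have : (q.1 - p.1) * cos th + (q.2 - p.2) * sin th <= 2 * (m / 2).
  by apply: coord_bound; rewrite ?cos2Dsin2// distrC.
by rewrite !innerE; lra.
Qed.

(** A support point cannot be interior: it could be pushed outwards. *)
Lemma support_point_boundary K h p th : supports K h ->
  inner2 p (udir th) = h th -> ~ K° p.
Proof.
move=> hK ph /nbhs_ballP[e /= e0 He].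
have [U _] := hK th; have e2 : 0 < e / 2 by rewrite divr_gt0.
have := U (p.1 + e / 2 * cos th, p.2 + e / 2 * sin th).
have -> : inner2 (p.1 + e / 2 * cos th, p.2 + e / 2 * sin th) (udir th) =
    h th + e / 2.
  by rewrite -ph !innerE/= -[e / 2 in RHS]mulr1 -(cos2Dsin2 th); ring.
rewrite gerDl leNgt e2 => H; apply/notF/H/He.
have bnd (c s : R) : c ^+ 2 + s ^+ 2 = 1 -> `|e / 2 * c| < e.
  move=> cs; have c1 : `|c| <= 1 by rewrite ler_norml; apply/andP; split; nra.
  rewrite normrM gtr0_norm// (@le_lt_trans _ _ (e / 2))//; last by lra.
  by rewrite ler_piMr// ltW.
split; rewrite /ball/= opprD addNKr normrN.
  by apply: (bnd _ (sin th)); exact: cos2Dsin2.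
by apply: (bnd _ (cos th)); rewrite addrC; exact: cos2Dsin2.
Qed.

End PlaneGeometry.

(** * The support function of a smooth body *)

Section SmoothBody.
Context {R : realType}.
Implicit Types (K : set (R * R)%type) (x y f g : R -> R).

Lemma smooth_is_derive x n : smooth x ->
  forall s : R, is_derive s 1 (derive1n n x) (derive1n n.+1 x s).
Proof.
move=> sx s; rewrite derive1nS derive1E; exact: derivableP (sx n s).
Qed.

Lemma smooth_continuous x n : smooth x -> continuous (derive1n n x).
Proof. by move=> sx; exact: derivable_continuous (smooth_is_derive _ n sx). Qed.

(** If [f2 s] were positive, [f1] would increase through 0 at [s], and [f] would exceed
    [f s] just to the right of [s]. *)
Lemma second_derivative_max f (f1 f2 : R -> R) (s : R) :
  (forall t : R, is_derive t 1 f (f1 t)) ->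
  (forall t : R, is_derive t 1 f1 (f2 t)) -> continuous f2 ->
  (forall t, f t <= f s) -> f1 s = 0 /\ f2 s <= 0.
Proof.
move=> df df1 cf2 fmax.
have f1s : f1 s = 0.
  have : is_derive s 1 f 0.
    apply: (@derive1_at_max _ f (s - 1) (s + 1)); first by lra.
    - by move=> t _; case: (df t).
    - by rewrite in_itv/=; apply/andP; split; lra.
    - by move=> t _; exact: fmax.
  by case: (df s) => _ <- [_].
split=> //; rewrite leNgt; apply/negP => f2s.
have /nbhs_ballP[e /= e0 He] : \forall t \near s, 0 < f2 t.
  by apply: (cvgr_gt _ (cf2 s)).
pose u := s + e / 2; have e2 : 0 < e / 2 by rewrite divr_gt0.
have su : s < u by rewrite ltrDl.
have [xi] := MVT su (fun t _ => df t) (continuous_subspaceT (derivable_continuous _ _ df)).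
rewrite in_itv/= => /andP[sxi xiu] Ef.
have [eta] := MVT sxi (fun t _ => df1 t) (continuous_subspaceT (derivable_continuous _ _ df1)).
rewrite in_itv/= => /andP[seta etaxi]; rewrite f1s subr0 => Ef1.
have f2eta : 0 < f2 eta.
  apply: He; rewrite /ball/= ltr_norml.
  by move: xiu; rewrite /u => xiu; apply/andP; split; lra.
have : 0 < f u - f s.
  by rewrite Ef Ef1 !mulr_gt0// subr_gt0.
by rewrite subr_gt0 ltNge fmax.
Qed.

Section Param.
Variables (K : set (R * R)%type) (x y : R -> R).
Hypotheses (cK : compact K) (vK : convex_set (M := (R * R)%type) K).
Hypothesis K0 : K !=set0.
Hypotheses (sx : smooth x) (sy : smooth y).
Hypothesis bK : closure K `\` K° = range (fun s => (x s, y s)).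

Let x1 := derive1n 1 x.
Let y1 := derive1n 1 y.
Let x2 := derive1n 2 x.
Let y2 := derive1n 2 y.

Let D (s : R) := x1 s * y2 s - y1 s * x2 s.
Hypothesis D0 : forall s, 0 < D s.

Let h := support_fun K.

Let hK : supports K h.
Proof. exact: compact_supports. Qed.

Let closureK : closure K = K.
Proof. by apply/esym/closure_id; apply: compact_closed => //; exact: norm_hausdorff. Qed.

Let range_sub s : K (x s, y s) /\ ~ K° (x s, y s).
Proof.
have : (closure K `\` K°) (x s, y s) by rewrite bK; exists s.
by rewrite closureK.
Qed.

Let dx (s : R) : is_derive s 1 x (x1 s).
Proof. exact: (smooth_is_derive _ 0 sx). Qed.
Let dy (s : R) : is_derive s 1 y (y1 s).
Proof. exact: (smooth_is_derive _ 0 sy). Qed.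
Let dx1 (s : R) : is_derive s 1 x1 (x2 s).
Proof. exact: (smooth_is_derive _ 1 sx). Qed.
Let dy1 (s : R) : is_derive s 1 y1 (y2 s).
Proof. exact: (smooth_is_derive _ 1 sy). Qed.

(** At a support point the velocity is orthogonal to [u] and the acceleration does not
    point outwards, so [D > 0] forces the velocity to be a positive multiple of the
    normal turned by a quarter. *)
Let support_velocity s th : x s * cos th + y s * sin th = h th ->
  exists2 k, 0 < k & x1 s = - k * sin th /\ y1 s = k * cos th.
Proof.
move=> hs.
have [||||f1s f2s] := @second_derivative_max
  (fun t => x t * cos th + y t * sin th)
  (fun t => x1 t * cos th + y1 t * sin th)
  (fun t => x2 t * cos th + y2 t * sin th) s.
- by move=> t; derive_to; ring.
- by move=> t; derive_to; ring.
- have cx2 : continuous x2 by exact: smooth_continuous.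
  have cy2 : continuous y2 by exact: smooth_continuous.
  by continuity_expr.
- move=> t; rewrite hs; have [U _] := hK th.
  by have := U _ (proj1 (range_sub t)).
pose k := - x1 s * sin th + y1 s * cos th.
have cs := cos2Dsin2 th.
have xk : x1 s = - k * sin th.
  rewrite -[LHS]mulr1 -cs /k.
  have -> : x1 s * (cos th ^+ 2 + sin th ^+ 2) =
    (x1 s * cos th + y1 s * sin th) * cos th - k * sin th by rewrite /k; ring.
  by rewrite f1s mul0r add0r mulNr.
have yk : y1 s = k * cos th.
  rewrite -[LHS]mulr1 -cs /k.
  have -> : y1 s * (cos th ^+ 2 + sin th ^+ 2) =
    (x1 s * cos th + y1 s * sin th) * sin th + k * cos th by rewrite /k; ring.
  by rewrite f1s mul0r add0r.
exists k => //.
have Ds : D s = - k * (x2 s * cos th + y2 s * sin th).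
  by rewrite /D xk yk; ring.
have := D0 s; rewrite Ds mulNr -mulrN; case: (ltP 0 k) => // k0.
by rewrite ltNge mulr_le0_ge0// oppr_ge0.
Qed.

Let velocity_support s th k : 0 < k -> x1 s = - k * sin th ->
  y1 s = k * cos th -> x s * cos th + y s * sin th = h th.
Proof.
move=> k0 xk yk; have [Ks nKs] := range_sub s.
have [ph hph] := boundary_supported _ _ _ cK vK hK Ks nKs.
have [l l0 [xl yl]] := support_velocity _ _ hph.
have kl : k = l.
  have : k ^+ 2 = l ^+ 2.
    rewrite -[LHS]mulr1 -[RHS]mulr1 -{1}(cos2Dsin2 th) -(cos2Dsin2 ph).
    have := congr1 (fun z => z ^+ 2) xl; have := congr1 (fun z => z ^+ 2) yl.
    by rewrite xk yk !exprMn !sqrrN => E1 E2; rewrite !mulrDr E1 E2.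
  by move/eqP; rewrite eqrXn2 ?ltW// => /eqP.
have kn0 : k != 0 by rewrite gt_eqF.
have u : udir th = udir ph.
  congr pair.
    by apply: (mulfI kn0); rewrite -yk yl kl.
  by apply: (mulfI (_ : - k != 0)); rewrite ?oppr_eq0// -xk xl kl.
have hU : h th = h ph by rewrite /h /support_fun u.
by rewrite hU -hph -u.
Qed.

Let support_param th : exists s, x s * cos th + y s * sin th = h th.
Proof.
have [_ [p Kp hp]] := hK th.
have : (closure K `\` K°) p.
  by split; [rewrite closureK|exact: support_point_boundary hK hp].
by rewrite bK => -[s _ E]; exists s; rewrite -hp -E.
Qed.

(** The angle of the velocity, measured from its value at [s0] by an arctangent. Its
    derivative [D / |velocity|^2] is positive, so it is a local coordinate of the
    boundary. *)
Let normal_angle th0 s0 : x s0 * cos th0 + y s0 * sin th0 = h th0 ->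
  exists e (phi : R -> R), [/\ 0 < e, phi s0 = th0,
    forall s, s \in `]s0 - e, s0 + e[ ->
      is_derive s 1 phi (D s / (x1 s ^+ 2 + y1 s ^+ 2)) &
    forall s, s \in `]s0 - e, s0 + e[ ->
      exists2 k, 0 < k & x1 s = - k * sin (phi s) /\ y1 s = k * cos (phi s)].
Proof.
move=> /support_velocity[k0 k00 [xk yk]].
(* components of the velocity along [- u(th0)] and along the quarter turn of [u(th0)] *)
pose a s : R := - (x1 s * cos th0 + y1 s * sin th0).
pose b s : R := - x1 s * sin th0 + y1 s * cos th0.
have da (s : R) : is_derive s 1 a (- (x2 s * cos th0 + y2 s * sin th0)).
  by rewrite /a; derive_to; ring.
have db (s : R) : is_derive s 1 b (- x2 s * sin th0 + y2 s * cos th0).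
  by rewrite /b; derive_to; ring.
have cs := cos2Dsin2 th0.
have bs0 : b s0 = k0.
  by rewrite -[RHS]mulr1 -cs /b xk yk; ring.
have as0 : a s0 = 0 by rewrite /a xk yk; ring.
have /nbhs_ballP[e /= e0 He] : \forall s \near s0, 0 < b s.
  by apply: (cvgr_gt _ (derivable_continuous _ _ db s0)); rewrite bs0.
have b0 s : s \in `]s0 - e, s0 + e[ -> 0 < b s.
  rewrite in_itv/= => /andP[? ?]; apply: He.
  by rewrite /ball/= ltr_norml; apply/andP; split; lra.
have ab s : a s ^+ 2 + b s ^+ 2 = x1 s ^+ 2 + y1 s ^+ 2.
  by rewrite -[RHS]mulr1 -cs /a /b; ring.
exists e, (fun s => th0 + atan (a s / b s)); split => //.
- by rewrite as0 mul0r atan0 addr0.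
- move=> s /b0 bs; have bn0 : b s != 0 by rewrite gt_eqF.
  have dV : is_derive s 1 (fun t => (b t)^-1)
      (- (b s) ^- 2 * (- x2 s * sin th0 + y2 s * cos th0)).
    exact: (@is_deriveV _ b s _ 1 bn0 (db s)).
  have dq : is_derive s 1 (fun t => a t / b t)
      (a s * (- (b s) ^- 2 * (- x2 s * sin th0 + y2 s * cos th0)) +
       - (x2 s * cos th0 + y2 s * sin th0) * (b s)^-1).
    exact: (is_deriveM_fun a (fun t => (b t)^-1)).
  have dat : is_derive s 1 (fun t => atan (a t / b t)) ((1 + (a s / b s) ^+ 2)^-1 * 
      (a s * (- (b s) ^- 2 * (- x2 s * sin th0 + y2 s * cos th0)) +
       - (x2 s * cos th0 + y2 s * sin th0) * (b s)^-1)).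
    exact: (is_derive_comp_fun atan).
  derive_to; rewrite add0r.
  have sq0 : a s ^+ 2 + b s ^+ 2 != 0.
    by rewrite gt_eqF// ltr_wpDl ?sqr_ge0// exprn_gt0.
  have Dab : D s = a s * (x2 s * sin th0 - y2 s * cos th0) -
       (x2 s * cos th0 + y2 s * sin th0) * b s.
    by rewrite -[LHS]mulr1 -cs /D /a /b; ring.
  rewrite Dab -ab; move: (a s) (b s) bn0 sq0 => u v vn0 uv0.
  by field; rewrite vn0 uv0.
- move=> s /b0 bs; have bn0 : b s != 0 by rewrite gt_eqF.
  have [z zE] : exists z, z = a s / b s by exists (a s / b s).
  have [kp kpE] : exists kp, kp = cos (atan z) by exists (cos (atan z)).
  rewrite -zE.
  have kp0 : 0 < kp.
    by rewrite kpE; apply: cos_gt0_pihalf; rewrite atan_gtNpi2 atan_ltpi2.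
  have sz : sin (atan z) = z * kp.
    rewrite -{2}(atanK z) /tan -kpE divfK//; exact: lt0r_neq0.
  have az : a s = z * b s by rewrite zE divfK.
  exists (b s / kp); first by rewrite divr_gt0.
  have kn0 : kp != 0 by exact: lt0r_neq0.
  have xab : x1 s = - a s * cos th0 - b s * sin th0.
    by rewrite -[LHS]mulr1 -cs /a /b; ring.
  have yab : y1 s = - a s * sin th0 + b s * cos th0.
    by rewrite -[LHS]mulr1 -cs /a /b; ring.
  rewrite xab yab sinD cosD sz -kpE az.
  move: (b s) => bs'.
  by split; field; exact: kn0.
Qed.

(** Inverting the local coordinate turns [h] into the explicit function
    [<(x, y), u> o g], whose derivatives are computed by the chain rule. *)
Let support_local (th0 : R) : exists H1 T : R -> R,
  [/\ \forall th \near th0, is_derive (th : R) 1 h (H1 th),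
      \forall th \near th0, is_derive (th : R) 1 H1 (T th - h th),
      {for th0, continuous T} & 0 < T th0].
Proof.
have [s0 hs0] := support_param th0.
have [e [phi [e0 phi0 dphi kphi]]] := normal_angle _ _ hs0.
pose I := `]s0 - e, s0 + e[%R.
pose v (s : R) : R := x1 s ^+ 2 + y1 s ^+ 2.
pose phi1 (s : R) : R := D s / v s.
have s0I : s0 \in I by rewrite in_itv/=; apply/andP; split; lra.
have v0 s : s \in I -> 0 < v s.
  move=> /kphi[k k0 [xk yk]]; rewrite /v xk yk.
  have -> : (- k * sin (phi s)) ^+ 2 + (k * cos (phi s)) ^+ 2 = k ^+ 2.
    by rewrite -[RHS]mulr1 -(cos2Dsin2 (phi s)); ring.
  by rewrite exprn_gt0.
have p0 s : s \in I -> 0 < phi1 s by move=> /v0 ?; rewrite divr_gt0.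
have cphi s : s \in I -> {for s, continuous phi}.
  by move=> /dphi; exact: is_derive_continuous.
have phi_inc s t : s \in I -> t \in I -> s < t -> phi s < phi t.
  move=> sI tI st; apply: (@gtr0_derive1_lt_oo _ phi (s0 - e) (s0 + e)) => //.
  - by move=> u /dphi[].
  - by move=> u uI; rewrite derive1E; case: (dphi u uI) => _ ->; exact: p0.
  - by move=> u; rewrite inE; exact: cphi.
have phi_inj : forall s t, s \in I -> t \in I -> phi s = phi t -> s = t.
  move=> s t sI tI E; case: (ltgtP s t) => // /phi_inc.
    by move=> /(_ sI tI); rewrite E ltxx.
  by move=> /(_ tI sI); rewrite E ltxx.
pose g := fun th : R => xget s0 [set t | t \in I /\ phi t = th].
have gphi s : s \in I -> g (phi s) = s.
  move=> sI; rewrite /g; case: xgetP => [t -> [tI /phi_inj]|/(_ s)]; first exact.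
  by case.
have nI s : s \in I -> \forall t \near s, t \in I by exact: near_in_itvoo.
have dg s : s \in I -> is_derive (phi s) 1 g (phi1 s)^-1.
  move=> sI; apply: is_derive_inverse.
  - by apply: filterS (nI s sI) => t; exact: gphi.
  - by apply: filterS (nI s sI) => t; exact: cphi.
  - exact: dphi.
  - by rewrite gt_eqF// p0.
have gth0 : g th0 = s0 by rewrite -phi0 gphi.
have cg0 : {for th0, continuous g}.
  by apply: (@is_derive_continuous _ _ _ (phi1 s0)^-1); rewrite -phi0; exact: dg.
have good : \forall th \near th0, g th \in I /\ phi (g th) = th.
  have gI : \forall th \near th0, g th \in I.
    by apply: (cg0 (fun s => s \in I)); rewrite gth0; exact: nI.
  have gK : {near phi s0, cancel g phi}.
    apply: near_continuous_can_sym.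
    - by apply: filterS (nI s0 s0I) => t; exact: cphi.
    - by apply: filterS (nI s0 s0I) => t; exact: gphi.
  by rewrite phi0 in gK; apply: filterS2 gI gK.
pose X (th : R) := x (g th) * cos th + y (g th) * sin th.
pose H1 (th : R) := - x (g th) * sin th + y (g th) * cos th.
pose k th := - x1 (g th) * sin th + y1 (g th) * cos th.
pose T (th : R) := k th * (phi1 (g th))^-1.
have hX th : g th \in I /\ phi (g th) = th -> h th = X th.
  move=> [gI gE]; have [l l0] := kphi _ gI; rewrite gE => -[xl yl].
  by rewrite /X (velocity_support _ _ _ l0 xl yl).
have der th : g th \in I /\ phi (g th) = th ->
    is_derive th 1 X (H1 th) /\ is_derive th 1 H1 (T th - X th).
  move=> [gI gE]; have dgt := dg _ gI; rewrite gE in dgt.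
  have dxg : is_derive th 1 (fun t => x (g t)) (x1 (g th) * (phi1 (g th))^-1).
    exact: is_derive_comp_fun.
  have dyg : is_derive th 1 (fun t => y (g t)) (y1 (g th) * (phi1 (g th))^-1).
    exact: is_derive_comp_fun.
  have [l l0] := kphi _ gI; rewrite gE => -[xl yl].
  split.
    by rewrite /X; derive_to; rewrite xl yl /H1; ring.
  by rewrite /H1; derive_to; rewrite /T /k /X; ring.
exists H1, T; split.
- apply: filterS (near_join good) => th gth.
  have [dX _] := der th (nbhs_singleton gth).
  apply: near_eq_is_derive dX.
  by apply: filterS gth => t /hX ->.
- by apply: filterS good => th gth; rewrite (hX th gth); have [] := der th gth.
- have cx1 : continuous x1 by exact: smooth_continuous.
  have cy1 : continuous y1 by exact: smooth_continuous.
  have cx2 : continuous x2 by exact: smooth_continuous.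
  have cy2 : continuous y2 by exact: smooth_continuous.
  have cc (f : R -> R) : continuous f -> {for th0, continuous (f \o g)}.
    by move=> cf; apply: continuous_comp => //; exact: cf.
  have cx := cc x1 cx1; have cy := cc y1 cy1.
  have cD : {for th0, continuous (D \o g)} by apply: cc; rewrite /D; continuity_expr.
  have cv : {for th0, continuous (v \o g)}.
    apply: cc; change (continuous (fun s => x1 s * x1 s + y1 s * y1 s)).
    by continuity_expr.
  apply: cvgM.
    apply: cvgD; apply: cvgM; [|exact: continuous_sin|exact: cy|exact: continuous_cos].
    by apply: cvgN; exact: cx.
  apply: cvgV; first by rewrite /= gth0 gt_eqF// p0.
  apply: cvgM; first exact: cD.
  by apply: cvgV; [rewrite /= gth0 gt_eqF// v0|exact: cv].
- have [l l0] := kphi _ s0I; rewrite phi0 => -[xl yl].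
  rewrite /T; apply: mulr_gt0; last by rewrite invr_gt0 gth0 p0.
  rewrite /k gth0 xl yl.
  have -> : - (- l * sin th0) * sin th0 + l * cos th0 * cos th0 = l.
    by rewrite -[RHS]mulr1 -(cos2Dsin2 th0); ring.
  by [].
Qed.

Lemma param_support_C2 :
  support_C2 h (derive1 h) (curv_radius K) /\ forall th, 0 < curv_radius K th.
Proof.
have dh (th : R) : is_derive th 1 h (derive1 h th).
  have [H1 [T [dH _ _ _]]] := support_local th; rewrite derive1E.
  by apply: derivableP; case: (nbhs_singleton dH).
have nE (th0 : R) : exists T : R -> R, [/\ is_derive th0 1 (derive1 h) (T th0 - h th0),
    (\forall th \near th0, curv_radius K th = T th), {for th0, continuous T} &
    0 < T th0].
  have [H1 [T [dH dH1 cT T0]]] := support_local th0.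
  have dhE : \forall th \near th0, H1 th = derive1 h th.
    by apply: filterS dH => th [_ <-]; rewrite derive1E.
  have dd : \forall th \near th0, is_derive (th : R) 1 (derive1 h) (T th - h th).
    by apply: filterS2 (near_join dhE) dH1 => th E; exact: near_eq_is_derive.
  exists T; split => //; first exact: nbhs_singleton dd.
  apply: filterS dd => th [_ E].
  by rewrite /curv_radius /= -/h -/(derive1 h) derive1E E addrC subrK.
split; last first.
  by move=> th; have [T [_ /nbhs_singleton -> _ ?]] := nE th.
split => //.
- by move=> th; have [T [d /nbhs_singleton -> _ _]] := nE th.
- move=> th; have [T [_ ET cT _]] := nE th.
  rewrite /continuous_at (nbhs_singleton ET : curv_radius K th = T th).
  by apply: cvg_trans cT; apply: near_eq_cvg; apply: filterS ET => t ->.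
- exact: supports_periodic hK.
Qed.

End Param.

(** Only the sign of the curvature matters: it makes the determinant of velocity and
    acceleration positive, so that the normal turns strictly counterclockwise. *)
Lemma smooth_support_C2 K : convex_body K -> smooth_strictly_convex K ->
  let h := support_fun K in
  support_C2 h (derive1 h) (curv_radius K) /\ forall th, 0 < curv_radius K th.
Proof.
move=> [cK vK oK _] [x [y [[sx sy] _ reg _ bK]]].
apply: (param_support_C2 K x y) => //; first by exists (0, 0).
move=> s; have [_] := reg s; rewrite /curvature.
set w := Num.sqrt _; have w0 : 0 <= (w ^+ 3)^-1 by rewrite invr_ge0 exprn_ge0// sqrtr_ge0.
by move=> Dw; rewrite ltNge; apply: contraTN Dw => D0; rewrite -leNgt mulr_le0_ge0.
Qed.

End SmoothBody.

(** * The area of a body in terms of its support function *)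

Section ChangeOfVariable.
Context {R : realType}.
Notation mu := (@lebesgue_measure R).
Variables (X X1 Y : R -> R) (a b : R).
Hypothesis ab : a < b.
Hypothesis dX : forall th : R, is_derive th 1 X (X1 th).
Hypotheses (cX1 : continuous X1) (cY : continuous Y).

Let cX : continuous X.
Proof. exact: derivable_continuous dX. Qed.

Let dX1 : derive1 X = X1.
Proof. by apply/funext => th; rewrite derive1E; case: (dX th). Qed.

Let derX : derivable_oo_LRcontinuous X a b.
Proof.
split; first by move=> th _; case: (dX th).
  by apply: cvg_at_right_filter; exact: cX.
by apply: cvg_at_left_filter; exact: cX.
Qed.

Let cX1a : cvg (derive1 X x @[x --> a^'+]).
Proof. by rewrite dX1; apply/cvg_ex; exists (X1 a); apply: cvg_at_right_filter; exact: cX1. Qed.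

Let cX1b : cvg (derive1 X x @[x --> b^'-]).
Proof. by rewrite dX1; apply/cvg_ex; exists (X1 b); apply: cvg_at_left_filter; exact: cX1. Qed.

Let inv (x : R) : R := xget a [set th | a <= th <= b /\ X th = x].

Let invK : {in `[a, b] &, injective X} -> {in `[a, b], cancel X inv}.
Proof.
move=> injX th thab; rewrite /inv; case: xgetP => [t -> [tab /injX]|/(_ th)].
  by apply => //; rewrite in_itv.
by case; split => //; move: thab; rewrite in_itv.
Qed.

Let cinvY (A : set R) : {within A, continuous inv} ->
  {within A, continuous (Y \o inv)}.
Proof.
move=> ci x; apply: (@continuous_comp (subspace A) R R inv Y); first exact: ci.
exact: cY.
Qed.

(** The two arcs of a convex curve are parametrized by the normal angle, whereas slices
    are indexed by the abscissa; continuity of the inverse of the abscissa lets the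
    integral of [G] be computed by substitution. *)
Lemma graph_decreasing : (forall th, a < th < b -> X1 th < 0) ->
  exists G, [/\ {within `[X b, X a], continuous G},
    forall th, a <= th <= b -> G (X th) = Y th &
    \int[mu]_(x in `[X b, X a]) G x = \int[mu]_(th in `[a, b]) (Y th * - X1 th)].
Proof.
move=> X1neg.
have decX : {in `[a, b] &, {homo X : x y /~ x < y}}.
  apply: ltr0_derive1_lt_cc; last exact: continuous_subspaceT.
  - by move=> th _; case: (dX th).
  - by move=> th; rewrite dX1 in_itv/=; exact: X1neg.
have injX : {in `[a, b] &, injective X}.
  move=> s t sI tI E; case: (ltgtP s t) => //.
    by move=> /(decX _ _ tI sI); rewrite E ltxx.
  by move=> /(decX _ _ sI tI); rewrite E ltxx.
have cinv : {within `[X b, X a], continuous inv}.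
  by apply: segment_can_ge_continuous; [exact: ltW|exact: continuous_subspaceT|exact: invK].
exists (Y \o inv); split; first exact: cinvY.
  by move=> th thab; rewrite /= invK// in_itv.
rewrite /Rintegral (integration_by_substitution_decreasing (ltW ab))//; last first.
- exact: cinvY.
- by rewrite dX1 => th _; exact: cX1.
congr fine; apply: eq_integral => th; rewrite inE => thab.
by rewrite dX1 /= !fctE /= invK.
Qed.

Lemma graph_increasing : (forall th, a < th < b -> 0 < X1 th) ->
  exists G, [/\ {within `[X a, X b], continuous G},
    forall th, a <= th <= b -> G (X th) = Y th &
    \int[mu]_(x in `[X a, X b]) G x = \int[mu]_(th in `[a, b]) (Y th * X1 th)].
Proof.
move=> X1pos.
have incX : {in `[a, b] &, {homo X : x y / x < y}}.
  apply: gtr0_derive1_lt_cc; last exact: continuous_subspaceT.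
  - by move=> th _; case: (dX th).
  - by move=> th; rewrite dX1 in_itv/=; exact: X1pos.
have injX : {in `[a, b] &, injective X}.
  move=> s t sI tI E; case: (ltgtP s t) => //.
    by move=> /(incX _ _ sI tI); rewrite E ltxx.
  by move=> /(incX _ _ tI sI); rewrite E ltxx.
have cinv : {within `[X a, X b], continuous inv}.
  by apply: segment_can_le_continuous; [exact: ltW|exact: continuous_subspaceT|exact: invK].
exists (Y \o inv); split; first exact: cinvY.
  by move=> th thab; rewrite /= invK// in_itv.
rewrite /Rintegral (integration_by_substitution_increasing (ltW ab))//; last first.
- exact: cinvY.
- by rewrite dX1 => th _; exact: cX1.
congr fine; apply: eq_integral => th; rewrite inE => thab.
by rewrite dX1 /= !fctE /= invK.
Qed.

End ChangeOfVariable.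

Section Area.
Context {R : realType}.
Notation mu := (@lebesgue_measure R).
Variables (K : set (R * R)%type) (h h1 S : R -> R).
Hypothesis vK : convex_set (M := (R * R)%type) K.
Hypotheses (hK : supports K h) (hC2 : support_C2 h h1 S).
Hypothesis S0 : forall th, 0 < S th.

Let X (th : R) := h th * cos th - h1 th * sin th.
Let Y (th : R) := h th * sin th + h1 th * cos th.

(** The support point in direction [th] is the point where the supporting lines
    of nearby directions meet: [h u + h' u']. *)
Lemma support_point_unique p th : K p -> inner2 p (udir th) = h th ->
  p = (X th, Y th).
Proof.
move=> Kp ph; have [dh _ _ _] := hC2.
pose g t := p.1 * cos t + p.2 * sin t - h t.
have dg (t : R) : is_derive t 1 g (p.2 * cos t - p.1 * sin t - h1 t).
  by rewrite /g; derive_to; ring.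
have g0 : is_derive th 1 g 0.
  apply: (@derive1_at_max _ g (th - 1) (th + 1)); first by lra.
  - by move=> t _; case: (dg t).
  - by rewrite in_itv/=; apply/andP; split; lra.
  - move=> t _; have [/(_ p Kp) U _] := hK t.
    by move: U ph; rewrite !innerE /g => U ->; rewrite subrr subr_le0.
have h1E : h1 th = p.2 * cos th - p.1 * sin th.
  have : p.2 * cos th - p.1 * sin th - h1 th = 0.
    by case: (dg th) g0 => _ <- [_ ->].
  by move/eqP; rewrite subr_eq0 => /eqP.
have cs := cos2Dsin2 th; rewrite /X /Y h1E -ph innerE.
case: p {Kp ph g dg g0 h1E} => p1 p2 /=; congr pair.
  by rewrite -[LHS]mulr1 -cs; ring.
by rewrite -[LHS]mulr1 -cs; ring.
Qed.

Lemma support_point_in th : K (X th, Y th).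
Proof. by have [_ [p Kp ph]] := hK th; rewrite -(support_point_unique _ _ Kp ph). Qed.

Lemma sin_le0_2pi (th : R) : pi <= th <= 2 * pi -> sin th <= 0.
Proof.
move=> /andP[t1 t2]; rewrite -[th](subrK pi) sinDpi oppr_le0.
by apply: sin_ge0_pi; apply/andP; split; lra.
Qed.

Lemma sin_lt0_2pi (th : R) : pi < th < 2 * pi -> sin th < 0.
Proof.
move=> /andP[t1 t2]; rewrite -[th](subrK pi) sinDpi oppr_lt0.
by apply: sin_gt0_pi; apply/andP; split; lra.
Qed.

Let slice_le p th : K p -> p.1 = X th ->
  p.2 * sin th <= Y th * sin th /\ (sin th = 0 -> p.2 = Y th).
Proof.
move=> Kp p1; have [U _] := hK th; have := U p Kp.
have [_ [q Kq qh]] := hK th; have E := support_point_unique _ _ Kq qh.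
rewrite -qh E !innerE/= p1 lerD2l; split => // s0.
have : inner2 p (udir th) = h th by rewrite -qh E !innerE/= p1 s0 !mulr0.
by move=> /(support_point_unique _ _ Kp) ->.
Qed.

Let slice_top p th : K p -> p.1 = X th -> 0 <= th <= pi -> p.2 <= Y th.
Proof.
move=> Kp p1 /sin_ge0_pi; have [le0 eq0] := slice_le _ _ Kp p1.
rewrite le_eqVlt => /predU1P[/esym/eq0 ->//|s0].
by rewrite -(ler_pM2r s0).
Qed.

Let slice_bottom p th : K p -> p.1 = X th -> pi <= th <= 2 * pi -> Y th <= p.2.
Proof.
move=> Kp p1 /sin_le0_2pi; have [le0 eq0] := slice_le _ _ Kp p1.
rewrite le_eqVlt => /predU1P[/eq0 ->//|s0].
by rewrite -(ler_nM2r s0).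
Qed.

Let dX (th : R) : is_derive th 1 X (- S th * sin th).
Proof. by have [dh dh1 _ _] := hC2; rewrite /X; derive_to; ring. Qed.

Let dY (th : R) : is_derive th 1 Y (S th * cos th).
Proof. by have [dh dh1 _ _] := hC2; rewrite /Y; derive_to; ring. Qed.

Let XK p : K p -> X pi <= p.1 <= X 0.
Proof.
move=> Kp; have [/(_ p Kp) U0 _] := hK 0; have [/(_ p Kp) Upi _] := hK pi.
move: U0 Upi; rewrite !innerE /X cos0 sin0 cospi sinpi.
by rewrite !mulr0 !mulr1 !subr0 !addr0 !mulrN1 => -> ?; rewrite andbT lerNl.
Qed.

Let X2pi : X (2 * pi) = X 0.
Proof.
rewrite /X -[2 * pi]add0r (support_periodic _ _ _ hC2) (support1_periodic _ _ _ hC2).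
by rewrite cos_periodic2 sin_periodic2.
Qed.

(** Fubini over vertical slices: the slice at abscissa [x] runs from the lower
    to the upper boundary arc, and both arcs are parametrized by [th]. *)
Lemma area_line_integral : area K = circ_int (fun th => Y th * (S th * sin th)).
Proof.
have pi0 := pi_gt0 R; have [dh dh1 cS ph] := hC2.
have cY := derivable_continuous _ _ dY.
have csin : continuous (fun th : R => sin th) by exact: continuous_sin.
have cX1 : continuous (fun th => - S th * sin th) by continuity_expr.
have pi2 : pi < 2 * pi :> R by lra.
have [th /andP[t0 t1]|T [cT TX iT]] := graph_decreasing _ _ _ _ _ pi0 dX cX1 cY.
  by rewrite mulNr oppr_lt0 mulr_gt0// sin_gt0_pi// t0.
have [th /sin_lt0_2pi s0|B [+ BX +]] := graph_increasing _ _ _ _ _ pi2 dX cX1 cY.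
  by rewrite mulNr -mulrN mulr_gt0// oppr_gt0.
rewrite X2pi => cB iB.
have XX : X pi <= X 0.
  by have /andP[] := XK _ (support_point_in pi).
have cX := derivable_continuous _ _ dX.
have surjT x : X pi <= x <= X 0 -> exists2 th, 0 <= th <= pi & X th = x.
  move=> xX; have [||th] := @IVT _ X 0 pi x (ltW pi0); first exact: continuous_subspaceT.
    by rewrite (min_idPr XX) (max_idPl XX).
  by rewrite in_itv => ? ?; exists th.
have surjB x : X pi <= x <= X 0 -> exists2 th, pi <= th <= 2 * pi & X th = x.
  move=> xX; have [||th] := @IVT _ X pi (2 * pi) x (ltW pi2); first exact: continuous_subspaceT.
    by rewrite X2pi (min_idPl XX) (max_idPr XX).
  by rewrite in_itv => ? ?; exists th.
have slice x : X pi <= x <= X 0 -> B x <= T x /\ xsection K x = `[B x, T x]%classic.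
  move=> xX; have [t t0 Et] := surjT x xX; have [u u0 Eu] := surjB x xX.
  have Kt := support_point_in t; have Ku := support_point_in u.
  have ET : T x = Y t by rewrite -Et TX.
  have EB : B x = Y u by rewrite -Eu BX.
  rewrite Et in Kt; rewrite Eu in Ku.
  have YY : Y u <= Y t by apply: (slice_top (x, Y u) t).
  rewrite ET EB; split => //; apply/seteqP; split => y; rewrite /xsection/= inE in_itv/=.
    by move=> Kxy; rewrite (slice_bottom (x, y) u)// (slice_top (x, y) t).
  move=> /andP[uy yt].
  have [E|ne] := eqVneq (Y t) (Y u).
    by rewrite (_ : y = Y t)//; apply/eqP; rewrite eq_le yt/= E.
  have d0 : 0 < Y t - Y u by rewrite subr_gt0 lt_neqAle eq_sym ne.
  pose l := (y - Y u) / (Y t - Y u).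
  have l0 : 0 <= l by rewrite divr_ge0 ?subr_ge0// ltW.
  have l1 : l <= 1 by rewrite ler_pdivrMr// mul1r lerD2r.
  have := convex_setE K vK _ _ l Kt Ku l0 l1 => /=.
  have ld : l * (Y t - Y u) = y - Y u by rewrite divfK// gt_eqF.
  rewrite (_ : l * x + (1 - l) * x = x); last by ring.
  by rewrite (_ : l * Y t + (1 - l) * Y u = y)//; move: ld; lra.
have sliceE x : mu (xsection K x) =
    ((fun z => (T z - B z)%:E) \_ `[X pi, X 0]%classic) x.
  rewrite patchE; case: ifPn => [|xX].
    rewrite inE/= in_itv/= => /slice[BT ->].
    rewrite lebesgue_measure_itv/= lte_fin; move: BT.
    by rewrite le_eqVlt => /predU1P[->|->//]; rewrite ltxx subrr.
  rewrite (_ : xsection K x = set0) ?measure0//.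
  apply/seteqP; split => // y; rewrite /xsection/= inE => /XK/= xX'.
  by case/negP: xX; rewrite inE/= in_itv.
have -> : area K = \int[mu]_(x in `[X pi, X 0]) (T x - B x).
  rewrite /area /product_measure1 /Rintegral [in RHS]integral_mkcond.
  by congr fine; apply: eq_integral => x _; exact: sliceE.
rewrite RintegralB//; try exact: continuous_itv_integrable.
have cYS : continuous (fun th => Y th * (S th * sin th)) by continuity_expr.
rewrite iT iB /circ_int (Rint_chasles _ 0 pi _ cYS (ltW pi0) (ltW pi2)).
congr +%R.
  by apply: eq_Rintegral => th _; ring.
rewrite -mulN1r -Rint_Zl; last by continuity_expr.
by apply: eq_Rintegral => th _; ring.
Qed.

Lemma area_support : area K = 2^-1 * circ_int (fun th => h th * S th).
Proof.
have [dh dh1 cS ph] := hC2; have cY := derivable_continuous _ _ dY.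
have ch := derivable_continuous _ _ dh.
have ccos : continuous (fun th : R => cos th) by exact: continuous_cos.
have csin : continuous (fun th : R => sin th) by exact: continuous_sin.
have cX := derivable_continuous _ _ dX.
rewrite area_line_integral -circ_intZ; last by continuity_expr.
apply/eqP; rewrite -subr_eq0 -circ_intB; [apply/eqP|by continuity_expr..].
apply: (circ_int_derive (fun th => - (2^-1 * (X th * Y th)))).
- move=> th; derive_to; rewrite /X /Y; have cs := cos2Dsin2 th.
  have -> : h th * S th = (h th * S th) * (cos th ^+ 2 + sin th ^+ 2) by rewrite cs mulr1.
  by field.
- by continuity_expr.
- have ph1 := support1_periodic _ _ _ hC2.
  by move=> th; rewrite /X /Y ph ph1 cos_periodic2 sin_periodic2.
Qed.

End Area.

(** * Mixed area and the relative Bonnesen inequality *)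

Section Bodies.
Context {R : realType}.
Implicit Types (K L : set (R * R)%type) (h k S T : R -> R).

Record regular_body K h (h1 : R -> R) S : Prop := RegularBody {
  body_convex : convex_body K;
  body_supports : supports K h;
  body_C2 : support_C2 h h1 S;
  body_radius_gt0 : forall th, 0 < S th }.

Lemma smooth_regular_body K : convex_body K -> smooth_strictly_convex K ->
  regular_body K (support_fun K) (derive1 (support_fun K)) (curv_radius K).
Proof.
move=> cK sK; have [C2 S0] := smooth_support_C2 K cK sK; split => //.
by case: cK => cptK _ oK _; apply: compact_supports => //; exists (0, 0).
Qed.

Section OneBody.
Variables (K : set (R * R)%type) (h h1 S : R -> R).
Hypothesis bK : regular_body K h h1 S.

Lemma body_support_ge0 th : 0 <= h th.
Proof.
have [[_ _ oK _] hK _ _] := bK; have [/(_ _ oK) + _] := hK th.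
by rewrite innerE !mul0r addr0.
Qed.

Lemma body_width_gt0 : 0 < h 0 + h pi.
Proof.
have [[_ _ _ [p /nbhs_ballP[e /= e0 He]]] hK _ _] := bK.
have e2 : 0 < e / 2 by rewrite divr_gt0.
have inK s : `|s| <= e / 2 -> K (p.1 + s, p.2).
  move=> se; apply: He; split; last exact: ballxx.
  by rewrite /ball/= opprD addNKr normrN; lra.
have [/(_ _ (inK (e / 2) _)) U0 _] := hK 0.
have [/(_ _ (inK (- (e / 2)) _)) Upi _] := hK pi.
have := U0; have := Upi; rewrite normrN gtr0_norm// lexx !innerE/=.
rewrite cos0 sin0 cospi sinpi => /(_ isT) U /(_ isT) V.
lra.
Qed.

Lemma body_area : area K = 2^-1 * circ_int (fun th => h th * S th).
Proof. by have [[_ vK _ _] hK C2 S0] := bK; exact: (area_support K h h1 S vK hK C2 S0). Qed.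

Lemma body_area_gt0 : 0 < area K.
Proof.
have [_ _ C2 S0] := bK; have pi0 := pi_gt0 R.
have ch := support_continuous _ _ _ C2; have cS := radius_continuous _ _ _ C2.
have hS th : 0 <= h th * S th by rewrite mulr_ge0 ?body_support_ge0// ltW.
rewrite body_area pmulr_rgt0 ?invr_gt0// lt_neqAle circ_int_ge0// andbT eq_sym.
apply/negP => /eqP I0.
have z th : 0 <= th <= 2 * pi -> h th = 0.
  have chS : continuous (fun th => h th * S th) by continuity_expr.
  move=> /(circ_int_eq0 _ chS hS I0)/eqP; rewrite mulf_eq0 (gt_eqF (S0 th)) orbF.
  by move=> /eqP.
have := body_width_gt0; rewrite !z ?addr0 ?ltxx//; apply/andP; split; lra.
Qed.

Lemma body_support_bounded : exists2 C, 0 < C & forall th, h th <= C.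
Proof.
have [_ hK C2 _] := bK; have ch := support_continuous _ _ _ C2.
have [c _ cmax] := EVT_max (ltW (@twopi_gt0 R)) (continuous_subspaceT ch).
exists (h c + 1); first by rewrite ltr_wpDl ?body_support_ge0.
move=> th; have [y y02 ->] := periodic_circle h th (support_periodic _ _ _ C2).
by rewrite ler_wpDr// cmax// in_itv.
Qed.

End OneBody.

Lemma supports_mink K L h k t : 0 < t -> supports K h -> supports L k ->
  supports (mink_add K (dilate t L)) (fun th => 1 * h th + t * k th).
Proof.
move=> t0 hK hL th; have [UK [p Kp ph]] := hK th; have [UL [q Lq qk]] := hL th.
split.
  move=> _ [x Kx [_ [y Ly <-] <-]].
  have -> : inner2 (x + t *: y) (udir th) =
    inner2 x (udir th) + t * inner2 y (udir th).
    by rewrite !innerE/= /GRing.scale/=; ring.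
  by rewrite mul1r lerD ?UK// ler_wpM2l ?UL// ltW.
exists (p + t *: q); first by exists p => //; exists (t *: q) => //; exists q.
by rewrite -ph -qk !innerE/= /GRing.scale/=; ring.
Qed.

Lemma convex_mink K L t : convex_set (M := (R * R)%type) K ->
  convex_set (M := (R * R)%type) L ->
  convex_set (M := (R * R)%type) (mink_add K (dilate t L)).
Proof.
move=> /convex_setE vK /convex_setE vL; apply: convex_setP.
move=> _ _ s [x Kx [_ [y Ly <-] <-]] [x' Kx' [_ [y' Ly' <-] <-]] s0 s1.
exists (s * x.1 + (1 - s) * x'.1, s * x.2 + (1 - s) * x'.2); first exact: vK.
exists (t *: (s * y.1 + (1 - s) * y'.1, s * y.2 + (1 - s) * y'.2)).
  by eexists; last reflexivity; exact: vL.
by congr pair; rewrite /= /GRing.scale/=; ring.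
Qed.

Section TwoBodies.
Variables (K L : set (R * R)%type) (h h1 S k k1 T : R -> R).
Hypotheses (bK : regular_body K h h1 S) (bL : regular_body L k k1 T).

Let C2K := body_C2 _ _ _ _ bK.
Let C2L := body_C2 _ _ _ _ bL.
Let ch : continuous h := support_continuous _ _ _ C2K.
Let ck : continuous k := support_continuous _ _ _ C2L.
Let cS : continuous S := radius_continuous _ _ _ C2K.
Let cT : continuous T := radius_continuous _ _ _ C2L.

(** By the symmetry [circ_int_sym], the quadratic form polarizing twice the area has a
    single mixed coefficient. *)
Lemma circ_int_lin a b :
  circ_int (fun th => (a * h th + b * k th) * (a * S th + b * T th)) =
  a ^+ 2 * circ_int (fun th => h th * S th)
  + 2 * a * b * circ_int (fun th => h th * T th)
  + b ^+ 2 * circ_int (fun th => k th * T th).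
Proof.
have sym := circ_int_sym _ _ _ _ _ _ C2K C2L.
have c1 : continuous (fun th => h th * S th) by continuity_expr.
have c2 : continuous (fun th => h th * T th) by continuity_expr.
have c3 : continuous (fun th => k th * S th) by continuity_expr.
have c4 : continuous (fun th => k th * T th) by continuity_expr.
have -> : 2 * a * b * circ_int (fun th => h th * T th) =
    a * b * circ_int (fun th => h th * T th) + a * b * circ_int (fun th => k th * S th).
  by rewrite -sym; ring.
rewrite -!circ_intZ//.
rewrite -circ_intD; [|by continuity_expr..].
rewrite -circ_intD; [|by continuity_expr..].
rewrite -circ_intD; [|by continuity_expr..].
by apply: eq_circ_int => th; ring.
Qed.

Lemma mixed_area_support : mixed_area K L = 2^-1 * circ_int (fun th => h th * T th).
Proof.
have [[_ vK _ _] hK _ S0] := bK; have [[_ vL _ _] hL _ T0] := bL.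
have steiner t : 0 < t -> area (mink_add K (dilate t L)) =
    area K + 2 * (2^-1 * circ_int (fun th => h th * T th)) * t + area L * t ^+ 2.
  move=> t0; rewrite (area_support _ _ _ _ (convex_mink _ _ t vK vL)
    (supports_mink _ _ _ _ _ t0 hK hL) (support_C2_lin _ _ _ _ _ _ C2K C2L 1 t)).
    rewrite circ_int_lin (body_area _ _ _ _ bK) (body_area _ _ _ _ bL).
    by field.
  by move=> th; rewrite mul1r addr_gt0// mulr_gt0.
apply: xget_unique; first exact: steiner.
move=> v /(_ 1 ltr01); rewrite (steiner 1 ltr01) !mulr1.
by move=> /addIr/addrI/mulfI E; rewrite E// pnatr_eq0.
Qed.

Lemma mixed_area_ge0 : 0 <= mixed_area K L.
Proof.
rewrite mixed_area_support mulr_ge0 ?invr_ge0// circ_int_ge0// => th.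
by rewrite mulr_ge0// ?(body_support_ge0 _ _ _ _ bK)// ltW// (body_radius_gt0 _ _ _ _ bL).
Qed.

End TwoBodies.

(** Subtract a small multiple of the cosine centred on the half circle: there it stays
    below the minimum of [f], and it is negative elsewhere. Geometrically, a body can
    be translated away from contacts confined to the opposite open half circle. *)
Lemma half_circle_push (f : R -> R) (th : R) : continuous f -> periodic f (2 * pi) ->
  (forall t, 0 <= f t) -> (forall t, th <= t <= th + pi -> f t != 0) ->
  exists w m, 0 < m /\ forall t, inner2 w (udir t) + m <= f t.
Proof.
move=> cf pf f0 fn0; have pi0 := pi_gt0 R.
have [||c] := @EVT_min _ f th (th + pi); first by rewrite lerDl ltW.
  exact: continuous_subspaceT.
rewrite in_itv/= => cth cmin.
have fc : 0 < f c by rewrite lt_neqAle eq_sym fn0 // f0.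
pose e := f c / 2; have e0 : 0 < e by rewrite divr_gt0.
pose w := (- (e * sin th), e * cos th).
have wE t : inner2 w (udir t) = e * sin (t - th) by rewrite innerE sinB /w/=; ring.
pose g t := f t - inner2 w (udir t).
have pg : periodic g (2 * pi).
  by move=> t; rewrite /g pf !innerE cos_periodic2 sin_periodic2.
have ccos : continuous (fun t : R => cos t) by exact: continuous_cos.
have csin : continuous (fun t : R => sin t) by exact: continuous_sin.
have cg : continuous g by rewrite /g /inner2 /=; continuity_expr.
have gpos t : 0 < g t.
  have pg' : periodic (fun s => g (s + th)) (2 * pi) by move=> s; rewrite addrAC pg.
  have [y /andP[y0 y2] /=] := periodic_circle _ (t - th) pg'.
  rewrite subrK => ->; rewrite /g wE addrK subr_gt0.
  have [ypi|ypi] := leP y pi.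
    apply: (@le_lt_trans _ _ e); first by rewrite ler_piMr ?sin_le1// ltW.
    apply: (@lt_le_trans _ _ (f c)); first by rewrite /e; lra.
    by apply: cmin; rewrite in_itv/=; apply/andP; split; lra.
  have [->|yn] := eqVneq y (2 * pi).
    rewrite -[2 * pi]add0r sin_periodic2 sin0 mulr0 add0r addrC pf.
    by rewrite lt_neqAle f0 andbT eq_sym fn0// lexx lerDl ltW.
  have /sin_lt0_2pi s0 : pi < y < 2 * pi by rewrite ypi lt_neqAle yn.
  by apply: (@lt_le_trans _ _ 0); rewrite ?f0// pmulr_rlt0.
have [m' _ mmin] := EVT_min (ltW (@twopi_gt0 R)) (continuous_subspaceT cg).
exists w, (g m'); split => // t; rewrite addrC -lerBrDr -/(g t).
by have [y y02 ->] := periodic_circle _ t pg; apply: mmin; rewrite in_itv.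
Qed.

Section Bonnesen.
Variables (K L : set (R * R)%type) (h h1 S k k1 T : R -> R).
Hypotheses (bK : regular_body K h h1 S) (bL : regular_body L k k1 T).
Hypothesis dil : dilation_position K L.

Let r := rel_inradius K L.
Let Ro := rel_outradius K L.

Let C2K := body_C2 _ _ _ _ bK.
Let C2L := body_C2 _ _ _ _ bL.
Let hK := body_supports _ _ _ _ bK.
Let hL := body_supports _ _ _ _ bL.

Let inner_homothet (p q : R * R) (t th : R) :
  inner2 (p + t *: q) (udir th) = inner2 p (udir th) + t * inner2 q (udir th).
Proof. by rewrite !innerE/= /GRing.scale/=; ring. Qed.

Lemma inradius_support (th : R) : r * k th <= h th.
Proof.
have [_ rLK _] := dil; have [_ [q Lq <-]] := hL th; have [U _] := hK th.
have Kq : K (r *: q) by apply: rLK; exists q.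
by have := U _ Kq; rewrite -[r *: q]add0r inner_homothet innerE !mul0r !add0r.
Qed.

Let outradius_ge0 : 0 <= Ro.
Proof.
rewrite /Ro /rel_outradius; set A := (X in inf X).
have [A0|A0] := pselect (A !=set0); first by apply: lb_le_inf => // t [/ltW].
by rewrite (_ : A = set0) ?inf0//; apply/seteqP; split => // t At; case: A0; exists t.
Qed.

Lemma outradius_support (th : R) : h th <= Ro * k th.
Proof.
have [_ _ KRL] := dil; have [_ [p Kp <-]] := hK th; have [U _] := hL th.
have [q Lq <-] := KRL _ Kp.
rewrite -[_ *: q]add0r inner_homothet innerE !mul0r !add0r.
by rewrite ler_wpM2l// U.
Qed.

Let outradius_gt0 : 0 < Ro.
Proof.
rewrite lt_neqAle outradius_ge0 andbT; apply/negP => /eqP R0.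
have := body_width_gt0 _ _ _ _ bK.
have := outradius_support 0; have := outradius_support pi; rewrite -R0 !mul0r.
lra.
Qed.

Let inradius_ge0 : 0 <= r.
Proof.
rewrite /r /rel_inradius; set A := (X in sup X).
have [[s As]|A0] := pselect (A !=set0); last first.
  by rewrite (_ : A = set0) ?sup0//; apply/seteqP; split => // s As; case: A0; exists s.
have [hs|hs] := pselect (has_sup A); last by rewrite sup_out.
by apply: le_trans (ub_le_sup (proj2 hs) As); case: As => /ltW.
Qed.

Let inradius_has_ubound :
  has_ubound [set t | 0 < t /\ exists x, translate x (dilate t L) `<=` K].
Proof.
exists ((h 0 + h pi) / (k 0 + k pi)) => t [t0 [x xLK]].
rewrite ler_pdivlMr; last exact: body_width_gt0 bL.
have [_ [q0 Lq0 <-]] := hL 0; have [_ [q1 Lq1 <-]] := hL pi.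
have [U0 _] := hK 0; have [U1 _] := hK pi.
have /U0 : K (x + t *: q0) by apply: xLK; exists (t *: q0) => //; exists q0.
have /U1 : K (x + t *: q1) by apply: xLK; exists (t *: q1) => //; exists q1.
rewrite !inner_homothet !innerE cos0 sin0 cospi sinpi; lra.
Qed.

(** By maximality of the inradius, the contact directions of [r L] with [K] meet
    every closed half circle: otherwise [r L] could be moved into the interior and
    enlarged. *)
Lemma inradius_contact (th : R) : exists z, th <= z <= th + pi /\ h z - r * k z = 0.
Proof.
apply: contrapT => nz.
have [|||t tth|w [m [m0 Hm]]] := half_circle_push (fun t => h t - r * k t) th.
- have ch := support_continuous _ _ _ C2K; have ck := support_continuous _ _ _ C2L.
  by continuity_expr.
- by move=> t; rewrite (support_periodic _ _ _ C2K) (support_periodic _ _ _ C2L).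
- by move=> t; rewrite subr_ge0 inradius_support.
- by apply/eqP => z; apply: nz; exists t.
have [C C0 HC] := body_support_bounded _ _ _ _ bL.
pose e := m / C; have e0 : 0 < e by rewrite divr_gt0.
have re0 : 0 < r + e by rewrite ltr_wpDl.
have [[cptK vK _ _] _ _ _] := bK.
have sub : translate w (dilate (r + e) L) `<=` K.
  move=> _ [_ [q Lq <-] <-]; apply: (halfplanes K h) => // t.
  have [/(_ q Lq) U _] := hL t; rewrite inner_homothet.
  have := Hm t; have : (r + e) * inner2 q (udir t) <= (r + e) * k t.
    by rewrite ler_wpM2l// ltW.
  have : e * k t <= m by rewrite /e mulrAC ler_pdivrMr// ler_wpM2l ?HC// ltW.
  rewrite mulrDl; lra.
have : r + e <= r by apply: ub_le_sup => //; split => //; exists w.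
by rewrite gerDl leNgt e0.
Qed.

(** By minimality of the outradius, [R L] could otherwise be moved so as to contain
    [K] in its interior, and shrunk. *)
Lemma outradius_contact (th : R) : exists z, th <= z <= th + pi /\ h z - Ro * k z = 0.
Proof.
apply: contrapT => nz.
have [|||t tth|w [m [m0 Hm]]] := half_circle_push (fun t => Ro * k t - h t) th.
- have ch := support_continuous _ _ _ C2K; have ck := support_continuous _ _ _ C2L.
  by continuity_expr.
- by move=> t; rewrite (support_periodic _ _ _ C2K) (support_periodic _ _ _ C2L).
- by move=> t; rewrite subr_ge0 outradius_support.
- by apply/eqP => z; apply: nz; exists t; split => //; rewrite -opprB z oppr0.
have [C C0 HC] := body_support_bounded _ _ _ _ bL.
(* the bound [Ro / 2] keeps [Ro - e] positive *)
pose e := Num.min (m / C) (Ro / 2).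
have e0 : 0 < e by rewrite lt_min !divr_gt0.
have eR : e <= Ro / 2 by rewrite ge_min lexx orbT.
have Re0 : 0 < Ro - e by move: outradius_gt0; lra.
have [[cptL vL _ _] _ _ _] := bL.
have sub : K `<=` translate (- w) (dilate (Ro - e) L).
  move=> p Kp; pose q := (Ro - e)^-1 *: (p + w).
  have qE : (Ro - e) *: q = p + w by rewrite scalerA divff ?scale1r// gt_eqF.
  exists ((Ro - e) *: q); last by rewrite qE addrC addrK.
  exists q => //; apply: (halfplanes L k) => // t.
  have [/(_ p Kp) U _] := hK t.
  rewrite -(ler_pM2l Re0).
  have -> : (Ro - e) * inner2 q (udir t) = inner2 p (udir t) + inner2 w (udir t).
    rewrite -[LHS]add0r -[X in X + _](_ : inner2 (0, 0) (udir t) = 0).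
      by rewrite -inner_homothet qE !innerE/=; ring.
    by rewrite innerE !mul0r addr0.
  have := Hm t; have : e * k t <= m.
    apply: (@le_trans _ _ (m / C * k t)).
      by rewrite ler_wpM2r ?(body_support_ge0 _ _ _ _ bL)// ge_min lexx.
    by rewrite mulrAC ler_pdivrMr// ler_wpM2l ?HC// ltW.
  by rewrite mulrBl; lra.
have : Ro <= Ro - e.
  by apply: ge_inf; [exists 0 => t [/ltW]|split => //; exists (- w)].
by rewrite lerDl leNgt oppr_lt0 e0.
Qed.

Lemma contact_steiner_le0 (t : R) :
  (forall th, exists z, th <= z <= th + pi /\ h z - t * k z = 0) ->
  area K - 2 * mixed_area K L * t + area L * t ^+ 2 <= 0.
Proof.
move=> Hz; have := wirtinger_circle _ _ _ (support_C2_lin _ _ _ _ _ _ C2K C2L 1 (- t)).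
rewrite (circ_int_lin _ _ _ _ _ _ _ _ bK bL) => H.
rewrite (mixed_area_support _ _ _ _ _ _ _ _ bK bL).
rewrite (body_area _ _ _ _ bK) (body_area _ _ _ _ bL).
have {}/H : forall th, exists z, th <= z <= th + pi /\ 1 * h z + - t * k z = 0.
  by move=> th; have [z [zth z0]] := Hz th; exists z; split => //; rewrite mul1r mulNr.
rewrite sqrrN; lra.
Qed.

Let A := area L.
Let V := mixed_area K L.
Let d := steiner_delta K L / A.

Let A0 : 0 < A. Proof. exact: body_area_gt0 bL. Qed.

(** The Steiner polynomial takes a nonpositive value at [- r]; completing the square
    there bounds its discriminant below. *)
Lemma minkowski_le : area K * A <= V ^+ 2.
Proof.
have := contact_steiner_le0 _ inradius_contact; rewrite -/V -/A => H.
rewrite -subr_ge0.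
have : 0 <= (A * r - V) ^+ 2 by rewrite sqr_ge0.
have : A * (area K - 2 * V * r + A * r ^+ 2) <= 0 by rewrite pmulr_rle0.
by move: (area K) => B; lra.
Qed.

Let contact_dist (t : R) : area K - 2 * V * t + A * t ^+ 2 <= 0 -> `|t - V / A| <= d.
Proof.
move=> H; rewrite -(ler_pM2l A0) -{1}(gtr0_norm A0) -normrM /d mulrCA divff ?mulr1 ?gt_eqF//.
have -> : A * (t - V / A) = A * t - V by field; rewrite gt_eqF.
rewrite -sqrtr_sqr /steiner_delta ler_wsqrtr// -/V -/A.
have : A * (area K - 2 * V * t + A * t ^+ 2) <= 0 by rewrite pmulr_rle0.
by move: (area K) => B; lra.
Qed.

(** The relative Bonnesen inequality places [r] and [R] between the opposites
    of the two roots, and the dilation position transfers this to [h / k]. *)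
Lemma bonnesen_support (th : R) : `|h th - V / A * k th| <= d * k th.
Proof.
have k0 := body_support_ge0 _ _ _ _ bL th.
have /ler_normlP[dr1 dr2] := contact_dist _ (contact_steiner_le0 _ inradius_contact).
have /ler_normlP[dR1 dR2] := contact_dist _ (contact_steiner_le0 _ outradius_contact).
rewrite ler_norml; apply/andP; split.
  rewrite -mulNr lerBrDr -mulrDl (le_trans _ (inradius_support th))// ler_wpM2r//.
  lra.
rewrite lerBlDr -mulrDl (le_trans (outradius_support th))// ler_wpM2r//; lra.
Qed.

End Bonnesen.
End Bodies.

(** * Strictly convex functions on the half-line *)

Section StrictlyConvex.
Context {R : realType}.
Variable F : R -> R.
Hypothesis hF : strictly_convex_on_pos F.

Lemma three_chords (x y z : R) : 0 < x -> x < y -> y < z ->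
  (F y - F x) * (z - y) < (F z - F y) * (y - x).
Proof.
move=> x0 xy yz; have xz := lt_trans xy yz.
have zx0 : 0 < z - x by rewrite subr_gt0.
have zxn : z - x != 0 by rewrite gt_eqF.
have := hF x z ((z - y) / (z - x)) x0 (lt_trans x0 xz).
rewrite (lt_eqF xz) divr_gt0 ?subr_gt0// ltr_pdivrMr// mul1r.
rewrite ltrD2l ltrN2 => /(_ isT isT xy).
have -> : (z - y) / (z - x) * x + (1 - (z - y) / (z - x)) * z = y by field.
have -> : (z - y) / (z - x) * F x + (1 - (z - y) / (z - x)) * F z =
  ((z - y) * F x + (y - x) * F z) / (z - x) by field.
rewrite ltr_pdivlMr//; lra.
Qed.

(** The slope is the supremum of the slopes of the chords on the left. *)
Lemma strict_tangent (p : R) : 0 < p ->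
  exists s, forall x, 0 < x -> x != p -> F p + s * (x - p) < F x.
Proof.
move=> p0; pose A := [set (F p - F x) / (p - x) | x in [set x | 0 < x < p]].
have A0 : A !=set0.
  by exists ((F p - F (p / 2)) / (p - p / 2)), (p / 2) => //=; apply/andP; split; lra.
have ubA y : p < y -> ubound A ((F y - F p) / (y - p)).
  move=> py _ [x /andP[x0 xp] <-].
  rewrite ler_pdivrMr ?subr_gt0// mulrAC ler_pdivlMr ?subr_gt0//.
  exact/ltW/three_chords.
have hub : has_ubound A by exists ((F (p + 1) - F p) / (p + 1 - p)); apply: ubA; lra.
exists (sup A).
have weak x : 0 < x -> F p + sup A * (x - p) <= F x.
  move=> x0; case: (ltgtP x p) => [xp|px|->]; last by rewrite subrr mulr0 addr0.
    have : (F p - F x) / (p - x) <= sup A by apply: ub_le_sup => //; exists x; rewrite /= ?x0.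
    by rewrite ler_pdivrMr ?subr_gt0//; lra.
  have : sup A <= (F x - F p) / (x - p) by apply: ge_sup => //; exact: ubA.
  by rewrite ler_pdivlMr ?subr_gt0//; lra.
move=> x x0 xp; rewrite lt_neqAle weak// andbT; apply/negP => /eqP E.
have half0 : 0 < 2^-1 :> R by rewrite invr_gt0.
have half1 : 2^-1 < 1 :> R by lra.
have := hF x p 2^-1 x0 p0 xp half0 half1.
have mid0 : 0 < 2^-1 * x + (1 - 2^-1) * p by lra.
have := weak _ mid0; rewrite -E; lra.
Qed.

Lemma strictly_convex_continuous (p : R) : 0 < p -> {for p, continuous F}.
Proof.
move=> p0; have [s Hs] := strict_tangent p p0.
(* near [p], the graph lies between the tangent and the chords to [p / 2] and [2 p] *)
pose c1 := (F (p / 2) - F p) / (p / 2); pose c2 := (F (2 * p) - F p) / p.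
pose M := `|s| + `|c1| + `|c2|.
have cM c : `|c| <= M -> forall x, c * (p - x) <= M * `|p - x|.
  by move=> cM x; rewrite (le_trans (ler_norm _))// normrM ler_wpM2r.
have [n0 n1 n2] : [/\ 0 <= `|s|, 0 <= `|c1| & 0 <= `|c2|] by [].
have sM : `|s| <= M by rewrite /M; move: n0 n1 n2; lra.
have c1M : `|c1| <= M by rewrite /M; move: n0 n1 n2; lra.
have c2M : `|- c2| <= M by rewrite normrN /M; move: n0 n1 n2; lra.
have bnd x : p / 2 < x -> x < 2 * p -> `|F p - F x| <= M * `|p - x|.
  move=> px xp; have x0 : 0 < x by lra.
  have [->|xnp] := eqVneq x p; first by rewrite !subrr normr0 mulr0.
  rewrite ler_norml lerNl opprB; apply/andP; split; last first.
    rewrite (le_trans _ (cM _ sM x))//.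
    by have := Hs x x0 xnp; lra.
  case: (ltgtP x p) xnp => // [xlt|xgt] _.
    rewrite (le_trans _ (cM _ c1M x))//.
    have p20 : 0 < p / 2 by lra.
    have := three_chords (p / 2) x p p20 px xlt.
    by rewrite /c1 mulrAC ler_pdivlMr//; lra.
  rewrite (le_trans _ (cM _ c2M x))//.
  have := three_chords p x (2 * p) p0 xgt xp.
  by rewrite /c2 -mulNr mulrAC ler_pdivlMr//; lra.
apply/cvgrPdist_lt => e e0.
have cD : M * `|p - x| @[x --> p] --> (0 : R).
  rewrite -(mulr0 M); apply: cvgM; first exact: cvg_cst.
  rewrite -[X in _ --> X](normr0 R) -[X in `|X|](subrr p); apply: cvg_norm.
  by apply: cvgB; [exact: cvg_cst|exact: cvg_id].
have nI : \forall x \near p, x \in `]p / 2, 2 * p[.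
  by apply: near_in_itvoo; rewrite in_itv/=; apply/andP; split; lra.
have /cvgrPdist_lt/(_ e e0) := cD; apply: filterS2 nI => x.
rewrite in_itv/= => /andP[px xp]; rewrite sub0r normrN; apply: le_lt_trans.
exact: le_trans (bnd x px xp) (ler_norm _).
Qed.

End StrictlyConvex.

(** * The inequality *)

Section Inequality.
Context {R : realType}.
Implicit Types (K L : set (R * R)%type) (h k S T : R -> R).

Lemma support_C2_unique h (h1 h1' S S' : R -> R) : support_C2 h h1 S ->
  support_C2 h h1' S' -> S =1 S'.
Proof.
move=> [dh dh1 _ _] [dh' dh1' _ _].
have E : h1 = h1' by apply/funext => th; case: (dh th) (dh' th) => _ <- [_ <-].
move=> th; rewrite E in dh1.
by case: (dh1 th) (dh1' th) => _ + [_ +] => -> /addIr.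
Qed.

Section TwoBodies.
Variables (K L : set (R * R)%type) (h h1 S k k1 T : R -> R) (F : R -> R).
Hypotheses (bK : regular_body K h h1 S) (bL : regular_body L k k1 T).
Hypothesis hF : strictly_convex_on_pos F.

Let C2K := body_C2 _ _ _ _ bK.
Let C2L := body_C2 _ _ _ _ bL.
Let ch : continuous h := support_continuous _ _ _ C2K.
Let ck : continuous k := support_continuous _ _ _ C2L.
Let cS : continuous S := radius_continuous _ _ _ C2K.
Let cT : continuous T := radius_continuous _ _ _ C2L.
Let S0 := body_radius_gt0 _ _ _ _ bK.
Let T0 := body_radius_gt0 _ _ _ _ bL.
Let k0 := body_support_ge0 _ _ _ _ bL.

Let A := area L.
Let B := area K.
Let V := mixed_area K L.
Let A0 : 0 < A := body_area_gt0 _ _ _ _ bL.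
Let B0 : 0 < B := body_area_gt0 _ _ _ _ bK.
Let a := V / A.
Let d := steiner_delta K L / A.

Definition curvature_functional : R :=
  circ_int (fun th => F (S th / T th) * k th * T th).

Lemma steiner_root1E : - steiner_root1 K L = a - d.
Proof. by rewrite /steiner_root1 -/V -/A /a /d; field; rewrite gt_eqF. Qed.

Lemma steiner_root2E : - steiner_root2 K L = a + d.
Proof. by rewrite /steiner_root2 -/V -/A /a /d; field; rewrite gt_eqF. Qed.

Let intT : circ_int (fun th => k th * T th) = 2 * A.
Proof. by rewrite /A (body_area _ _ _ _ bL); field. Qed.

Let intV : circ_int (fun th => h th * T th) = 2 * V.
Proof. by rewrite /V (mixed_area_support _ _ _ _ _ _ _ _ bK bL); field. Qed.

Let intV' : circ_int (fun th => k th * S th) = 2 * V.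
Proof. by rewrite -(circ_int_sym _ _ _ _ _ _ C2K C2L) intV. Qed.

Let intS : circ_int (fun th => h th * S th) = 2 * B.
Proof. by rewrite /B (body_area _ _ _ _ bK); field. Qed.

(** A compact convex set is determined by its support function. *)
Lemma proportional_homothetic (c : R) : 0 < c -> (forall th, h th = c * k th) ->
  homothetic K L.
Proof.
move=> c0 hE; exists (0, 0), c; split => //.
have [[cptK vK _ _] hK _ _] := bK; have [[cptL vL _ _] hL _ _] := bL.
have zadd (p : R * R) : (0, 0) + p = p by rewrite -[RHS]add0r.
have innerZ (p : R * R) th : inner2 (c *: p) (udir th) = c * inner2 p (udir th).
  by rewrite !innerE/= /GRing.scale/=; ring.
apply/seteqP; split => [p Kp|_ [_ [q Lq <-] <-]].
  exists p => //; exists (c^-1 *: p); last by rewrite scalerA divff ?scale1r// gt_eqF.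
  apply: (halfplanes L k) => // th.
  rewrite -(ler_pM2l c0) -innerZ scalerA divff ?gt_eqF// scale1r -hE.
  by have [/(_ p Kp) ? _] := hK th.
rewrite zadd; apply: (halfplanes K h) => // th; rewrite innerZ hE ler_pM2l//.
by have [/(_ q Lq) ? _] := hL th.
Qed.

(** For homothetic bodies the two roots coincide and [S / T] is constant. *)
Lemma homothetic_equality : homothetic K L ->
  A^-1 * curvature_functional = F (- steiner_root1 K L) + F (- steiner_root2 K L).
Proof.
move=> [x [t [t0 KE]]]; have An0 : A != 0 by rewrite gt_eqF.
have hE th : h th = (x.1 * cos th + x.2 * sin th) * 1 + t * k th.
  have [_ hK _ _] := bK; have [_ hL _ _] := bL.
  suff /(supports_unique _ _ _ hK) -> :
    supports K (fun th => (x.1 * cos th + x.2 * sin th) * 1 + t * k th) by [].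
  have innerD (p : R * R) ph : inner2 (x + t *: p) (udir ph) =
    x.1 * cos ph + x.2 * sin ph + t * inner2 p (udir ph).
    by rewrite !innerE/= /GRing.scale/=; ring.
  move=> ph; rewrite KE mulr1; split.
    move=> _ [_ [q Lq <-] <-]; rewrite innerD lerD2l ler_pM2l//.
    by have [/(_ q Lq) ? _] := hL ph.
  have [_ [q Lq <-]] := hL ph; exists (x + t *: q); last exact: innerD.
  by exists (t *: q) => //; exists q.
have trg := trig_C2 x.1 x.2.
have C2K' := support_C2_lin _ _ _ _ _ _ trg C2L 1 t.
have hE' : h = fun th => 1 * (x.1 * cos th + x.2 * sin th) + t * k th.
  by apply/funext => th; rewrite hE mulr1 mul1r.
rewrite -hE' in C2K'.
have SE th : S th = t * T th.
  by rewrite (support_C2_unique _ _ _ _ _ C2K C2K') mulr0 add0r.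
have VE : V = t * A.
  have : 2 * V = t * (2 * A).
    rewrite -intV' -intT -circ_intZ; last by continuity_expr.
    by apply: eq_circ_int => th; rewrite SE; ring.
  lra.
have BE : B = t * V.
  have : 2 * B = t * (2 * V).
    rewrite -intS -intV -circ_intZ; last by continuity_expr.
    by apply: eq_circ_int => th; rewrite SE; ring.
  lra.
have d0 : d = 0.
  rewrite /d /steiner_delta -/V -/A -/B BE VE.
  by rewrite (_ : _ - _ = 0) ?sqrtr0 ?mul0r//; ring.
have aE : a = t by rewrite /a VE mulfK.
rewrite steiner_root1E steiner_root2E d0 subr0 addr0 aE.
have -> : curvature_functional = circ_int (fun th => F t * (k th * T th)).
  apply: eq_circ_int => th; rewrite SE mulfK ?gt_eqF//; ring.
by rewrite circ_intZ ?intT; [field|continuity_expr].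
Qed.

Section Strict.
Hypothesis dil : dilation_position K L.

Let d_ge0 : 0 <= d.
Proof. by rewrite divr_ge0 ?sqrtr_ge0// ltW. Qed.

Let BE : B = A * (a ^+ 2 - d ^+ 2).
Proof.
have An0 : A != 0 by rewrite gt_eqF.
have : steiner_delta K L ^+ 2 = V ^+ 2 - B * A.
  by rewrite sqr_sqrtr// subr_ge0; exact: (minkowski_le _ _ _ _ _ _ _ _ bK bL dil).
move=> dE; have -> : B = (V ^+ 2 - steiner_delta K L ^+ 2) / A by rewrite dE; field.
by rewrite /a /d; field.
Qed.

Let VE : V = a * A.
Proof. by rewrite /a divfK// gt_eqF. Qed.

Let a_ge0 : 0 <= a.
Proof. by rewrite divr_ge0 ?(mixed_area_ge0 _ _ _ _ _ _ _ _ bK bL)// ltW. Qed.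

Let d_lt_a : d < a.
Proof.
rewrite ltNge; apply/negP => ad; move: B0; rewrite BE pmulr_rgt0// subr_gt0.
by rewrite ltNge lerXn2r// nnegrE.
Qed.

Lemma steiner_delta0_homothetic : d = 0 -> homothetic K L.
Proof.
move=> d0; apply: (proportional_homothetic a); first by rewrite -d0.
move=> th; have := bonnesen_support _ _ _ _ _ _ _ _ bK bL dil th.
by rewrite -/V -/A -/a -/d d0 mul0r normr_le0 subr_eq0 => /eqP.
Qed.

Let rho th := S th / T th.

Let rho0 th : 0 < rho th.
Proof. by rewrite divr_gt0. Qed.

Let crho : continuous rho.
Proof.
move=> th; apply: cvgM; first exact: cS.
by apply: cvgV; [rewrite gt_eqF|exact: cT].
Qed.

(** The points where [k > 0] are dense, since [k = 0] near a point would give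
    [T = k + k'' = 0] there. So [rho] takes only the values [a - d] and [a + d], and
    it is constant by continuity; but its mean for the weight [k T] is [a]. *)
Let two_valued_absurd : 0 < d ->
  (forall th, 0 < k th -> (rho th - a) ^+ 2 = d ^+ 2) -> False.
Proof.
move=> dp Hk.
have H th : (rho th - a) ^+ 2 = d ^+ 2.
  apply/eqP; apply: contrapT => /negP ne.
  have [dk dk1 _ _] := C2L.
  pose g t := (rho t - a) * (rho t - a) - d * d.
  have cg : continuous g.
    have [ca cd] : continuous (fun _ : R => a) /\ continuous (fun _ : R => d).
      by split; exact: continuous_cst_fun.
    by rewrite /g; continuity_expr.
  have nz : \forall t \near th, k t = 0.
    have nn : \forall t \near th, g t != 0.
      by apply: (cvgr_neq0 _ (cg th)); rewrite /g -!expr2 subr_eq0.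
    apply: filterS nn => t; apply: contraNeq => kt; rewrite /g -!expr2 subr_eq0 Hk//.
    by rewrite lt_neqAle eq_sym kt k0.
  have nz1 : \forall t \near th, k1 t = 0.
    apply: filterS (near_join nz) => t nt.
    have : is_derive t 1 k 0.
      apply: (near_eq_is_derive _ (is_derive_cst_fun 0 t)).
      by apply: filterS nt => u ->.
    by case: (dk t) => _ <- [_ ->].
  have d0 : is_derive th 1 k1 0.
    apply: (near_eq_is_derive _ (is_derive_cst_fun 0 th)).
    by apply: filterS nz1 => u ->.
  have : T th - k th = 0 by case: (dk1 th) d0 => _ <- [_ ->].
  by rewrite (nbhs_singleton nz) subr0 => E; have := T0 th; rewrite E ltxx.
pose g t := rho t - a.
have cg : continuous g by rewrite /g; continuity_expr.
have gn0 t : g t != 0.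
  by apply/eqP => gt0; move: (H t); rewrite -/(g t) gt0 expr0n/= => /esym/eqP;
    rewrite sqrf_eq0 gt_eqF.
have gcst t : g t = g 0.
  have : g t ^+ 2 = g 0 ^+ 2 by rewrite /g !H.
  move=> /eqP; rewrite eqf_sqr => /orP[/eqP//|/eqP gN].
  have zero s u : s <= u -> g s = - g u -> False.
    move=> su E; have [||x _ /eqP] := @IVT _ g s u 0 su; last by rewrite (negbTE (gn0 x)).
      exact: continuous_subspaceT.
    by rewrite ge_min le_max E oppr_le0 oppr_ge0; case: (leP 0 (g u)) => [_|/ltW ->]; rewrite ?orbT.
  case: (leP t 0) => [/zero/(_ gN)//|/ltW/zero].
  by rewrite gN opprK => /(_ erefl).
have : 2 * V = (a + g 0) * (2 * A).
  rewrite -intV' -intT -circ_intZ; last by continuity_expr.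
  apply: eq_circ_int => th; rewrite -(gcst th) /g /rho addrC subrK.
  by field; rewrite gt_eqF.
rewrite VE => E; have : g 0 * A = 0 by lra.
by move/eqP; rewrite mulf_eq0 (negbTE (gn0 0)) (gt_eqF A0).
Qed.

(** With [w = (h - a k) / d], [|w| <= k], the point [F rho] lies above both tangent
    lines of [F] at [a + d] and [a - d]; averaging them with the weights
    [(k - w) / 2] and [(k + w) / 2] gives a bound whose integral is known exactly. *)
Lemma strict_inequality : 0 < d ->
  F (- steiner_root1 K L) + F (- steiner_root2 K L) < A^-1 * curvature_functional.
Proof.
move=> dp; rewrite steiner_root1E steiner_root2E.
have am : 0 < a - d by rewrite subr_gt0.
have ap : 0 < a + d by rewrite ltr_wpDl.
have [sm Hm] := strict_tangent F hF (a - d) am.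
have [sp Hp] := strict_tangent F hF (a + d) ap.
pose lm x := F (a - d) + sm * (x - (a - d)).
pose lp x := F (a + d) + sp * (x - (a + d)).
have lmF x : 0 < x -> lm x <= F x.
  have [->|ne x0] := eqVneq x (a - d); first by rewrite /lm subrr mulr0 addr0.
  exact/ltW/Hm.
have lpF x : 0 < x -> lp x <= F x.
  have [->|ne x0] := eqVneq x (a + d); first by rewrite /lp subrr mulr0 addr0.
  exact/ltW/Hp.
pose w th := h th - a * k th.
have wk th : - (d * k th) <= w th /\ w th <= d * k th.
  have := bonnesen_support _ _ _ _ _ _ _ _ bK bL dil th.
  by rewrite -/V -/A -/a -/d -/(w th) ler_norml => /andP.
pose E th := (d * k th - w th) * (F (rho th) - lp (rho th)) * T th +
  (d * k th + w th) * (F (rho th) - lm (rho th)) * T th.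
have cFrho : continuous (fun th => F (rho th)).
  move=> th; apply: (@continuous_comp _ _ _ rho F); first exact: crho.
  exact: strictly_convex_continuous.
have cE : continuous E by rewrite /E /w /lp /lm; continuity_expr.
have E1 th : 0 <= (d * k th - w th) * (F (rho th) - lp (rho th)) * T th.
  have [_ ?] := wk th.
  by rewrite !mulr_ge0// ?subr_ge0// ?lpF// ltW.
have E2 th : 0 <= (d * k th + w th) * (F (rho th) - lm (rho th)) * T th.
  have [wk1 _] := wk th.
  have w0 : 0 <= d * k th + w th by rewrite addrC -lerBlDr sub0r.
  by rewrite !mulr_ge0// ?subr_ge0 ?lmF// ltW.
have E0 th : 0 <= E th by rewrite addr_ge0.
have rT th : rho th * T th = S th by rewrite /rho divfK// gt_eqF.
pose pp := F (a + d) - sp * (a + d); pose pm := F (a - d) - sm * (a - d).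
have EE th : E th = 2 * d * (F (rho th) * k th * T th)
   - ((d + a) * pp + (d - a) * pm) * (k th * T th)
   - ((d + a) * sp + (d - a) * sm) * (k th * S th)
   + (pp - pm) * (h th * T th)
   + (sp - sm) * (h th * S th).
  by rewrite -rT /E /w /lp /lm /pp /pm; ring.
have intE : circ_int E = 2 * d * (curvature_functional - A * (F (a - d) + F (a + d))).
  transitivity (2 * d * curvature_functional
    - ((d + a) * pp + (d - a) * pm) * (2 * A)
    - ((d + a) * sp + (d - a) * sm) * (2 * V)
    + (pp - pm) * (2 * V) + (sp - sm) * (2 * B)).
    rewrite (eq_circ_int _ _ EE) circ_intD; [|by continuity_expr..].
    rewrite circ_intD; [|by continuity_expr..].
    rewrite circ_intB; [|by continuity_expr..].
    rewrite circ_intB; [|by continuity_expr..].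
    rewrite !circ_intZ; try by continuity_expr.
    by rewrite intT intV intV' intS.
  by rewrite BE VE /pp /pm; ring.
have : 0 < circ_int E.
  rewrite lt_neqAle circ_int_ge0// andbT eq_sym; apply/negP => /eqP I0.
  apply: two_valued_absurd => // th kth.
  have pE : periodic E (2 * pi).
    move=> t; rewrite /E /w /rho (support_periodic _ _ _ C2K) (support_periodic _ _ _ C2L).
    by rewrite (radius_periodic _ _ _ C2K) (radius_periodic _ _ _ C2L).
  have Eth : E th = 0.
    have [y y02 ->] := periodic_circle E th pE.
    exact: circ_int_eq0 I0 _ y02.
  have [ne|ne] := eqVneq (rho th) (a + d); first by rewrite ne addrAC subrr add0r.
  have [ne'|ne'] := eqVneq (rho th) (a - d); first by rewrite ne' addrAC subrr add0r sqrrN.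
  have := Hm _ (rho0 th) ne'; have := Hp _ (rho0 th) ne.
  rewrite -/(lm _) -/(lp _) => Lp Lm.
  move/eqP: Eth; rewrite /E paddr_eq0// !mulf_eq0 !(gt_eqF (T0 th)) !orbF.
  rewrite !subr_eq0 (gt_eqF Lp) (gt_eqF Lm) !orbF => /andP[/eqP e1 /eqP e2].
  have : 0 < d * k th by rewrite mulr_gt0.
  by move: e1 e2; lra.
have d2 : 0 < 2 * d by rewrite mulr_gt0.
rewrite intE (pmulr_rgt0 _ d2) subr_gt0 => H.
by rewrite -(ltr_pM2l A0) mulrA divff ?mul1r// gt_eqF.
Qed.

End Strict.
End TwoBodies.
End Inequality.

Theorem theorem1p1 (R : realType) (K L : set (R * R)%type) (F : R -> R)
  (hK : convex_body K) (hL : convex_body L)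
  (sK : smooth_strictly_convex K) (sL : smooth_strictly_convex L)
  (hKL : dilation_position K L)
  (hF : strictly_convex_on_pos F) :
  let lhs : R := (area L)^-1 *
    \int[@lebesgue_measure R]_(theta in `[0, 2 * pi])
      (F (rel_curv_radius K L theta) * support_fun L theta * curv_radius L theta) in
  let rhs : R := F (- steiner_root1 K L) + F (- steiner_root2 K L) in
  rhs <= lhs /\ (lhs = rhs <-> homothetic K L).
Proof.
have bK := smooth_regular_body K hK sK; have bL := smooth_regular_body L hL sL.
move=> lhs rhs.
have eq := homothetic_equality _ _ _ _ _ _ _ _ F bK bL.
have lt := strict_inequality _ _ _ _ _ _ _ _ F bK bL hF hKL.
have hom := steiner_delta0_homothetic _ _ _ _ _ _ _ _ bK bL hKL.
have d0 : 0 <= steiner_delta K L / area L.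
  by rewrite divr_ge0 ?sqrtr_ge0// ltW// (body_area_gt0 _ _ _ _ bL).
have [dE|dn] := eqVneq (steiner_delta K L / area L) 0.
  have H := hom dE; have E : lhs = rhs by exact: eq.
  by rewrite E; split.
have rl : rhs < lhs by apply: lt; rewrite lt_neqAle eq_sym dn.
split; first exact: ltW.
split=> [E|/eq E]; first by rewrite E ltxx in rl.
by have : lhs = rhs by []; move=> E'; rewrite E' ltxx in rl.
Qed.
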